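(* The map $\pi_{3\to1}\colon\mathcal{T}^3(\mathbb{T}^2)\to\mathcal{T}^1(\mathbb{T}^2)$ is not surjective; that is, there exists a $C^1$ Anosov diffeomorphism of the $2$-torus which is not $C^1$ conjugate to any $C^3$ Anosov diffeomorphism.
   Context: For a closed manifold $M$ and $r\geq1$, let $\mathcal{X}^r(M)$ be the space of $C^r$ Anosov diffeomorphisms of $M$, and let $\mathrm{Diff}^r(M)$ be the group of $C^r$ diffeomorphisms of $M$ which are homotopic to the identity. $\mathrm{Diff}^r(M)$ acts on $\mathcal{X}^r(M)$ by conjugation, and $\mathcal{T}^r(M)=\mathcal{X}^r(M)/\mathrm{Diff}^r(M)$ is the quotient (the Teichm\''uller space of $C^r$ conjugacy classes). For $r>s\geq1$, the map $\pi_{r\to s}\colon\mathcal{T}^r(M)\to\mathcal{T}^s(M)$ is induced by the inclusion and quotient maps $$\mathcal{X}^r(M)/\mathrm{Diff}^r(M)\subset\mathcal{X}^s(M)/\mathrm{Diff}^r(M)\to\mathcal{X}^s(M)/\mathrm{Diff}^s(M).$$ A diffeomorphism $f$ is Anosov if $TM$ admits a $Df$-invariant splitting $TM=E^s\oplus E^u$ with $E^s$ uniformly contracted and $E^u$ uniformly expanded by $Df$. *)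

(* Defs.v *)
From HB Require Import structures.
From mathcomp Require Import all_boot all_order all_algebra.
From mathcomp Require Import ring_quotient.
From mathcomp Require Import all_classical all_reals all_analysis.

Set Implicit Arguments.
Unset Strict Implicit.
Unset Printing Implicit Defensive.

Import Order.TTheory GRing.Theory Num.Theory.
Import numFieldTopology.Exports numFieldNormedType.Exports.

Local Open Scope classical_set_scope.
Local Open Scope ring_scope.

Definition Z2 (R : realType) : pred 'rV[R]_2 :=
  fun x => x \is a mxOver (Num.int : {pred R}).

Lemma Z2_zmod_closed (R : realType) : zmod_closed (Z2 (R := R)).
Proof.
split; first by apply/mxOverP => i j; rewrite mxE rpred0.
by move=> x y /mxOverP hx /mxOverP hy; apply/mxOverP => i j; rewrite !mxE rpredB.
Qed.

HB.instance Definition _ (R : realType) :=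
  GRing.isZmodClosed.Build 'rV[R]_2 (Z2 (R := R)) (Z2_zmod_closed R).

Definition Z2_closed (R : realType) : zmodClosed 'rV[R]_2 :=
  GRing.ZmodClosed.clone 'rV[R]_2 (Z2 (R := R)) _.

(* R^2 / Z^2 with the quotient topology and the quotient group structure. *)
Definition torus2_quot (R : realType) := Quotient.quot (Z2_closed R).

Definition torus2 (R : realType) : Type :=
  quotient_topology (torus2_quot R).

HB.instance Definition _ (R : realType) := Topological.on (torus2 R).
HB.instance Definition _ (R : realType) := GRing.isZmodule.Build (torus2 R)
  (@Quotient.addqA _ (Z2_closed R)) (@Quotient.addqC _ (Z2_closed R))
  (@Quotient.add0q _ (Z2_closed R)) (@Quotient.addNq _ (Z2_closed R)).

Definition tpi (R : realType) (x : 'rV[R]_2) : torus2 R :=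
  \pi_(torus2_quot R)%qT x.

(* The representative of z in [-1/2, 1/2)^2: an inverse of tpi near 0. *)
Definition tlog (R : realType) (z : torus2 R) : 'rV[R]_2 :=
  \row_i (let x := repr (z : torus2_quot R) 0 i in
          x - (Num.floor (x + 2^-1))%:~R).

(* The expression of f near p in the charts v |-> p + tpi v at p and
   w |-> f p + tpi w at f p. *)
Definition in_chart (R : realType) (f : torus2 R -> torus2 R) (p : torus2 R) :
    'rV[R]_2 -> 'rV[R]_2 :=
  fun v => tlog (f (p + tpi v) - f p).

(* F is of class C^r on the open set U. Since V is used in finite dimension
   only, the continuity (resp. C^r-regularity) of x |-> 'd F x is that of all
   the directional derivatives x |-> 'd F x v. *)
Fixpoint Cr_on (R : realType) (V W : normedModType R) (r : nat) (U : set V)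
    (F : V -> W) : Prop :=
  if r is s.+1 then
    (forall x, U x -> differentiable F x) /\
    (forall v, Cr_on s U (fun x => 'd F x v))
  else forall x, U x -> {for x, continuous F}.

Definition Cr (R : realType) (r : nat) (f : torus2 R -> torus2 R) : Prop :=
  forall p, exists U : set 'rV[R]_2, [/\ open U, U 0 & Cr_on r U (in_chart f p)].

(* The two charts above trivialise the tangent bundle as torus2 R * R^2, and
   tangent f p : R^2 -> R^2 is D_p f read in this trivialisation. *)
Definition tangent (R : realType) (f : torus2 R -> torus2 R) (p : torus2 R) :
    'rV[R]_2 -> 'rV[R]_2 :=
  'd (in_chart f p) 0.

Definition diffeo (R : realType) (r : nat) (h k : torus2 R -> torus2 R) : Prop :=
  [/\ cancel h k, cancel k h, Cr r h & Cr r k].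

(* A splitting of the tangent bundle into two continuous subbundles; the
   continuity of Es and Eu is expressed by that of the projections. *)
Definition splitting (R : realType)
    (Es Eu : torus2 R -> {vspace 'rV[R]_2}) : Prop :=
  [/\ forall p, (Es p + Eu p = fullv)%VS,
      forall p, (Es p :&: Eu p = 0)%VS,
      forall v, continuous (fun p => daddv_pi (Es p) (Eu p) v : 'rV[R]_2)
    & forall v, continuous (fun p => daddv_pi (Eu p) (Es p) v : 'rV[R]_2)].

Definition invariant_field (R : realType) (f : torus2 R -> torus2 R)
    (E : torus2 R -> {vspace 'rV[R]_2}) : Prop :=
  forall p, (linfun (tangent f p) @: E p = E (f p))%VS.

Definition contracted (R : realType) (f : torus2 R -> torus2 R)
    (E : torus2 R -> {vspace 'rV[R]_2}) : Prop :=
  exists C lambda : R, [/\ 0 < C, 0 < lambda < 1 &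
    forall n p v, v \in E p ->
      `|tangent (iter n f) p v| <= C * lambda ^+ n * `|v| ].

Definition expanded (R : realType) (f : torus2 R -> torus2 R)
    (E : torus2 R -> {vspace 'rV[R]_2}) : Prop :=
  exists C lambda : R, [/\ 0 < C, 0 < lambda < 1 &
    forall n p v, v \in E p ->
      `|v| <= C * lambda ^+ n * `|tangent (iter n f) p v| ].

Definition anosov (R : realType) (r : nat) : set (torus2 R -> torus2 R) :=
  [set f | (exists k, diffeo r f k) /\
    exists Es Eu, [/\ splitting Es Eu, invariant_field f Es,
      invariant_field f Eu, contracted f Es & expanded f Eu]].

Arguments anosov R r : clear implicits.

Definition homotopic_id (R : realType) (h : torus2 R -> torus2 R) : Prop :=
  exists H : R * torus2 R -> torus2 R,
    [/\ {within `[0%R, 1%R]%classic `*` setT, continuous H},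
        forall p, H (0, p) = p & forall p, H (1, p) = h p].

(* The orbit of f under conjugation by the group Diff^r of C^r diffeomorphisms
   homotopic to the identity. *)
Definition conj_orbit (R : realType) (r : nat) (f : torus2 R -> torus2 R) :
    set (torus2 R -> torus2 R) :=
  [set g | exists h k, [/\ diffeo r h k, homotopic_id h & g = h \o f \o k]].

(* T^r = X^r / Diff^r, as the set of orbits. *)
Definition teichmuller (R : realType) (r : nat) :
    set (set (torus2 R -> torus2 R)) :=
  [set conj_orbit r f | f in anosov R r].

Arguments teichmuller R r : clear implicits.

(* The map T^r -> T^s induced by X^r \subset X^s, for s <= r. An orbit C of
   Diff^r is sent to its saturation Diff^s . C, which is the Diff^s-orbit of any
   element of C; the formula involves s only, r enters through the domain. *)
Definition teich_map (R : realType) (s : nat)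
    (C : set (torus2 R -> torus2 R)) : set (torus2 R -> torus2 R) :=
  \bigcup_(f in C) conj_orbit s f.

Arguments teich_map R s C : clear implicits.

(* Main.v *)
Require Import Defs.
From HB Require Import structures.
From mathcomp Require Import all_boot all_order all_algebra.
From mathcomp Require Import ring lra.
From mathcomp Require Import all_classical all_reals all_analysis.

Set Implicit Arguments.
Unset Strict Implicit.
Unset Printing Implicit Defensive.

Import Order.TTheory GRing.Theory Num.Theory.
Import numFieldTopology.Exports numFieldNormedType.Exports.

(** A C^1 conjugacy preserves the speed at which orbits on the unstable manifold
of a fixed point converge backwards to it, up to multiplicative constants. For a
C^2 diffeomorphism this speed is exactly geometric: if [y_{n+1}] is the preimage
of [y_n] and [s_n] is the unstable coordinate of [y_n], then
[s_n = l s_{n+1} + O(s_{n+1}^2)], and since [s_n] is summable, [l^n s_n] stays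
away from 0. So it suffices to find a C^1 Anosov diffeomorphism with a fixed
point at which [l^n t_n] tends to 0 along the unstable manifold.

The example is the linear automorphism [L] with matrix (2 1; 1 0), pushed along
its own unstable direction: [Fcat x = L x + psi (x 0 1) *: eu], where [eu]
is the eigenvector of [L] for [lam = 1 + sqrt 2] and [psi] is a small 1-periodic
C^1 function. The perturbation preserves the line field spanned by [eu], so the
unstable bundle is constant, and it acts on the quotient by this line field as
[L] does. The slope of the stable bundle over [eu] therefore solves an affine
equation over the dynamics whose linear part is a contraction
([affine_cocycle_solution]); this gives the continuous splitting without any cone
argument ([anosov_fcat]). The inverse map is explicit up to the inverse of the
increasing function [Phi t = lam * t + psi t].

On the unstable line of the fixed point 0 the map is [t |-> Phi t]. The
profile is [eta s = s / (4 - ln (s ^+ 2))] composed with a sine: it is C^1 with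
[eta' 0 = 0], but [eta s / s] decays only like [1 / |ln s|]. If
[lam ^+ n * t_n] stayed away from 0 along a backward orbit, the relative
corrections to the linear map would be at least of order [1 / n], and the
divergence of the harmonic series would make this product tend to 0
([slow_profile_forces_decay]). This
contradicts the behaviour of C^2 germs ([quadratic_recursion_no_decay]), and
[no_smooth_germ] puts the two together. In the comparison the unstable coordinate
of the smooth map is read through the linear form [cu \o dK], [dK] being the
differential of the inverse conjugacy: it is an eigenform of the differential of
the smooth map, so no invariant manifold of that map is involved.

Finally, an orbit of C^3 Anosov maps sent by [teich_map] to the orbit of [fcat]
would contain a map which is C^1 conjugate to [fcat]. *)

(** * A slowly varying C^1 profile *)

Section profile.
Context {R : realType}.
Local Open Scope classical_set_scope.
Local Open Scope ring_scope.
Implicit Types s t : R.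

(** The value at 0 is imposed by continuity. The constant 4 keeps the denominator
away from 0 on [[-1, 1]] and makes [deta] small. *)
Definition logmod s : R := if s == 0 then 0 else (4 - ln (s ^+ 2))^-1.

Definition eta s : R := s * logmod s.

Definition deta s : R := logmod s + 2 * logmod s ^+ 2.

Lemma near_neq0 s : s != 0 -> \forall x \near s, x != 0.
Proof.
move=> s0; have : open_nbhs s [set x | x != 0] by split => //; exact: open_neq.
by move/open_nbhs_nbhs.
Qed.

Lemma logmod0 : logmod 0 = 0.
Proof. by rewrite /logmod eqxx. Qed.

Lemma logmodE s : s != 0 -> logmod s = (4 - ln (s ^+ 2))^-1.
Proof. by move=> s0; rewrite /logmod (negbTE s0). Qed.

Lemma logmod_den s : `|s| <= 1 -> 4 <= 4 - ln (s ^+ 2).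
Proof.
move=> s1; rewrite lerDl oppr_ge0 ln_le0// -real_normK ?num_real//.
by rewrite expr_le1.
Qed.

Lemma logmod_ge0 s : `|s| <= 1 -> 0 <= logmod s.
Proof.
move=> s1; rewrite /logmod; case: ifP => // _.
by rewrite invr_ge0 (le_trans _ (logmod_den s1)).
Qed.

Lemma logmod_le s : `|s| <= 1 -> logmod s <= 4^-1.
Proof.
move=> s1; rewrite /logmod; case: ifP => _; first by rewrite invr_ge0.
by rewrite lef_pV2 ?posrE ?(lt_le_trans _ (logmod_den s1))// logmod_den.
Qed.

Lemma is_derive_ln_sqr s : s != 0 ->
  is_derive s 1 (fun x : R => 4 - ln (x ^+ 2)) (- (2 / s)).
Proof.
move=> s0.
have s2 : 0 < s ^+ 2 by rewrite exprn_even_gt0.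
have Dsqr : is_derive s 1 (fun x : R => x ^+ 2) (2 * s).
  by apply: is_derive_eq; rewrite /GRing.scale /= mulr1 mulr_natl.
have Dln : is_derive s 1 (@ln R \o (fun x : R => x ^+ 2)) ((s ^+ 2)^-1 * (2 * s)).
  by apply: is_derive1_comp; exact: is_derive1_ln.
have -> : (fun x => 4 - ln (x ^+ 2)) = cst 4 - (@ln R \o (fun x : R => x ^+ 2)).
  by apply/funext.
by apply: is_derive_eq; rewrite sub0r; congr (- _); field.
Qed.

(** At 0 this is the divergence of [ln]; the derivative [deta] inherits it, so that
[eta] is C^1 even though [eta s / s] tends to 0 slower than any power. *)
Lemma continuous_logmod s : `|s| <= 1 -> {for s, continuous logmod}.
Proof.
move=> s1; have [->|s0] := eqVneq s 0.
  rewrite /prop_for /continuous_at logmod0; apply/cvgrPdist_le => e e0.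
  near=> x; rewrite sub0r normrN /logmod; case: ifPn => [_|x0].
    by rewrite normr0 ltW.
  have x2 : x ^+ 2 < expR (- e^-1).
    rewrite -real_normK ?num_real// expr2.
    have x1 : `|x| < 1.
      by near: x; apply: (@nbhs0_lt R R^o).
    have : `|x| < expR (- e^-1) by near: x; apply: (@nbhs0_lt R R^o); rewrite expR_gt0.
    by apply: le_lt_trans; rewrite ler_piMl// ltW.
  have : ln (x ^+ 2) < - e^-1.
    by rewrite -ltr_expR lnK// posrE exprn_even_gt0.
  rewrite ltrNr => lt; have ei : 0 < e^-1 by rewrite invr_gt0.
  rewrite gtr0_norm ?invr_gt0; last by lra.
  by rewrite -[leRHS]invrK lef_pV2 ?posrE//; lra.
have ct : {for s, continuous (fun x : R => (4 - ln (x ^+ 2))^-1 : R)}.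
  apply: continuousV; first by rewrite gt_eqF// (lt_le_trans _ (logmod_den s1)).
  apply/differentiable_continuous/derivable1_diffP.
  by have [] := is_derive_ln_sqr s0.
rewrite /prop_for /continuous_at (logmodE s0); apply: cvg_trans ct.
apply: near_eq_cvg; near=> x; rewrite /logmod ifN//.
by near: x; exact: near_neq0.
Unshelve. all: by end_near. Qed.

(** At 0 the slope function of [eta] is [logmod], whose continuity gives the
derivative. *)
Lemma is_derive_eta s : `|s| <= 1 -> is_derive s 1 eta (deta s).
Proof.
move=> s1; have [->|s0] := eqVneq s 0.
  apply/is_derive1_caratheodory; exists logmod; split.
  - by move=> z; rewrite /eta mul0r !subr0 mulrC.
  - by apply: continuous_logmod; rewrite normr0.
  - by rewrite /deta logmod0 expr0n mulr0 addr0.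
have den0 : 4 - ln (s ^+ 2) != 0.
  by rewrite gt_eqF// (lt_le_trans _ (logmod_den s1)).
have D := is_derive_ln_sqr s0.
have DV := @is_deriveV R _ s _ 1 den0 D.
have De := @is_deriveM R R id _ s 1 _ _ (is_derive_id s 1) DV.
apply: (near_eq_is_derive (f := id * fun x : R => (4 - ln (x ^+ 2))^-1)) => //.
  near=> x; rewrite /eta /logmod ifN//.
  by near: x; exact: near_neq0.
apply: (is_derive_eq De); rewrite /deta (logmodE s0) /=.
by rewrite /GRing.scale /=; field; rewrite den0.
Unshelve. all: by end_near. Qed.

Lemma continuous_deta s : `|s| <= 1 -> {for s, continuous deta}.
Proof.
move=> /continuous_logmod ct.
apply: continuousD => //; apply: continuousM; first exact: cst_continuous.
exact: (continuous_comp ct (@exprn_continuous R 2 _)).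
Qed.

Lemma deta_bound s : `|s| <= 1 -> `|deta s| <= 3 / 8.
Proof.
move=> s1; have := logmod_ge0 s1; have := logmod_le s1; rewrite /deta.
set m := logmod s => m4 m0.
have m2 : m ^+ 2 <= 4^-1 * m by rewrite expr2 ler_wpM2r.
have mm0 : 0 <= m ^+ 2 by rewrite exprn_ge0.
by rewrite ger0_norm; lra.
Qed.

(** The sine makes the profile 1-periodic and keeps its argument in [[-1, 1]]. *)
Definition psi t : R := eta (sin (2 * pi * t)) / 8.

Definition dpsi t : R := deta (sin (2 * pi * t)) * cos (2 * pi * t) * (2 * pi) / 8.

Lemma is_derive_psi t : is_derive t 1 psi (dpsi t).
Proof.
have D1 : is_derive t 1 ( *%R (2 * pi : R)) (2 * pi).
  by apply: is_derive_eq; rewrite /GRing.scale /= mulr1.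
have D2 : is_derive t 1 (@sin R \o *%R (2 * pi)) (cos (2 * pi * t) * (2 * pi)).
  exact: is_derive1_comp.
have D3 : is_derive t 1 (eta \o (@sin R \o *%R (2 * pi)))
    (deta (sin (2 * pi * t)) * (cos (2 * pi * t) * (2 * pi))).
  by apply: is_derive1_comp; apply: is_derive_eta; exact: sin_max.
have -> : psi = 8^-1 *: (eta \o (@sin R \o *%R (2 * pi))).
  by apply/funext => x; rewrite /psi mulrC.
by apply: is_derive_eq; rewrite /dpsi /GRing.scale /=; ring.
Qed.

Lemma continuous_dpsi : continuous dpsi.
Proof.
move=> t; have c1 : {for t, continuous ( *%R (2 * pi : R))}.
  exact: mulrl_continuous.
have c2 : {for t, continuous (@sin R \o *%R (2 * pi : R))}.
  by apply: continuous_comp => //; exact: continuous_sin.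
have c3 : {for t, continuous (@cos R \o *%R (2 * pi : R))}.
  by apply: continuous_comp => //; exact: continuous_cos.
have c4 : {for t, continuous (deta \o (@sin R \o *%R (2 * pi : R)))}.
  by apply: continuous_comp => //; apply: continuous_deta; exact: sin_max.
have -> : dpsi = (deta \o (@sin R \o *%R (2 * pi))) *
    (@cos R \o *%R (2 * pi)) * cst (2 * pi / 8).
  by apply/funext => x; rewrite /dpsi -mulrA.
apply: (@continuousM R R); last exact: cst_continuous.
exact: (@continuousM R R).
Qed.

Lemma dpsi_bound t : `|dpsi t| <= 2^-1.
Proof.
have d := deta_bound (sin_max (2 * pi * t)); have c := cos_max (2 * pi * t).
have p4 : (pi : R) < 4 by have := @pihalf_lt2 R; lra.
have p0 : (0 : R) < pi := pi_gt0 R.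
have n8 : `|8^-1 : R| = 8^-1 by rewrite ger0_norm.
have n2 : `|2 : R| = 2 by rewrite ger0_norm.
rewrite /dpsi !normrM n8 n2 (gtr0_norm p0).
have dc : `|deta (sin (2 * pi * t))| * `|cos (2 * pi * t)| <= 3 / 8.
  by rewrite -[3 / 8]mulr1 ler_pM.
set D := _ * `|cos _| in dc *.
have D0 : 0 <= D by rewrite mulr_ge0.
have : D * (2 * pi) <= (3 / 8) * (2 * 4) by apply: ler_pM => //; lra.
lra.
Qed.

Lemma psi0 : psi 0 = 0.
Proof. by rewrite /psi mulr0 sin0 /eta !mul0r. Qed.

Lemma dpsi0 : dpsi 0 = 0.
Proof. by rewrite /dpsi mulr0 sin0 /deta logmod0 expr0n mulr0 addr0 !mul0r. Qed.

Lemma period1_int (T : Type) (f : R -> T) : (forall x, f (x + 1) = f x) ->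
  forall (n : int) x, f (x + n%:~R) = f x.
Proof.
move=> f1; have fN n x : f (x + n%:R) = f x.
  by elim: n => [|n IH]; rewrite ?addr0// -natr1 addrA f1.
by case=> n x; rewrite ?NegzE ?mulrNz -?pmulrn// -(fN n.+1) subrK.
Qed.

Lemma psi_period (n : int) t : psi (t + n%:~R) = psi t.
Proof.
apply: period1_int => {}t.
by rewrite /psi mulrDr mulr1 [2 * pi]mulr_natl sinD2pi.
Qed.

Lemma dpsi_period (n : int) t : dpsi (t + n%:~R) = dpsi t.
Proof.
apply: period1_int => {}t.
by rewrite /dpsi mulrDr mulr1 [2 * pi]mulr_natl sinD2pi cosD2pi.
Qed.

(** Near 0, [sin (2 * pi * t)] is at least [t], and [logmod] is increasing in the
modulus. *)
Lemma psi_lower : exists2 d : R, 0 < d < 1 &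
  forall t, 0 < t < d -> t / (8 * (4 - 2 * ln t)) <= psi t.
Proof.
have : \forall x \near (0 : R), 2^-1 < cos x.
  have := @continuous_cos R 0; rewrite /continuous_at cos0 => /cvgrPdist_lt.
  move=> /(_ 2^-1); rewrite invr_gt0 ltr0n => /(_ isT); apply: filterS => x.
  by rewrite ltr_norml => /andP[]; lra.
case/nbhs_ballP => e /= e0 cosx.
pose d : R := Num.min (e / 8) (1 / 2); exists d.
  by rewrite lt_min gt_min divr_gt0 //= divr_gt0//=; apply/orP; right; lra.
move=> t /andP[t0 td].
have [te t2] : t < e / 8 /\ t < 1 / 2 by move: td; rewrite lt_min => /andP.
have p4 : (pi : R) < 4 by have := @pihalf_lt2 R; lra.
have p2 : (2 : R) <= pi := pi_ge2 R.
set x := 2 * pi * t.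
have x0 : 0 < x by rewrite /x; nra.
have xe : x < e by rewrite /x; nra.
have xt : 4 * t <= x by rewrite /x; nra.
have sx : t <= sin x.
  have [|c cx] := @MVT_segment R sin cos 0 x (ltW x0) (fun y _ => is_derive_sin y).
    by apply: continuous_subspaceT; exact: continuous_sin.
  rewrite sin0 !subr0 => ->.
  have : 2^-1 < cos c.
    apply: cosx; rewrite /ball /= sub0r normrN.
    by move: cx; rewrite in_itv /= => /andP[c0 cx]; rewrite ger0_norm//; lra.
  nra.
have s0 : 0 < sin x by lra.
rewrite /psi -/x /eta logmodE ?gt_eqF//.
have dt : 4 - ln (sin x ^+ 2) <= 4 - 2 * ln t.
  have : ln t <= ln (sin x) by rewrite ler_ln ?posrE.
  by rewrite lnXn// mulr2n; lra.
have ds : 4 <= 4 - ln (sin x ^+ 2) by apply: logmod_den; exact: sin_max.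
rewrite invfM mulrCA mulrC; apply: ler_wpM2r; first by rewrite invr_ge0.
apply: ler_pM => //; first exact: ltW.
  by rewrite invr_ge0; lra.
by rewrite lef_pV2 ?posrE; lra.
Qed.

End profile.

(** * Inverse functions and coordinates in the plane *)

Section inverse.
Context {R : realType}.
Local Open Scope classical_set_scope.
Local Open Scope ring_scope.

Lemma is_derive1_continuous (f : R -> R) (t c : R) :
  is_derive t 1 f c -> {for t, continuous f}.
Proof.
by case=> fD _; apply: differentiable_continuous; apply/derivable1_diffP.
Qed.

Lemma derive_lower_bound_expands (f df : R -> R) (c : R) :
  (forall t : R, is_derive t 1 f (df t)) -> (forall t, c <= df t) ->
  forall a b, a <= b -> c * (b - a) <= f b - f a.
Proof.
move=> fD dfc a b ab.
have [|x _ ->] := @MVT_segment R f df a b ab (fun y _ => fD y).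
  by apply: continuous_subspaceT => t; exact: is_derive1_continuous (fD t).
by rewrite ler_wpM2r// subr_ge0.
Qed.

Lemma derivable_inverse (f df : R -> R) (c : R) : 0 < c ->
  (forall t : R, is_derive t 1 f (df t)) -> (forall t, c <= df t) ->
  exists g, [/\ cancel f g, cancel g f &
    forall y : R, is_derive y 1 g (df (g y))^-1].
Proof.
move=> c0 fD dfc.
have fC : continuous f.
  by move=> t; exact: is_derive1_continuous (fD t).
have fE := derive_lower_bound_expands fD dfc.
have f_inj : injective f.
  move=> a b; wlog ab : a b / a <= b.
    by move=> H; case/orP: (le_total a b) => /H// H' /esym /H'.
  move=> fab; have := fE _ _ ab; rewrite fab subrr pmulr_rle0// subr_le0 => ba.
  by apply/le_anti; rewrite ab.
have f_surj y : exists t, f t = y.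
  pose M := `|y - f 0| / c.
  have cM : c * M = `|y - f 0| by rewrite /M mulrCA divff ?gt_eqF// mulr1.
  have M0 : 0 <= M by rewrite divr_ge0// ltW.
  have up := fE 0 M M0; have := fE (- M) 0; rewrite oppr_le0 => /(_ M0) dn.
  move: up dn; rewrite subr0 sub0r opprK cM => up dn.
  have [] := @IVT R f (- M) M y; first by lra.
  - exact: continuous_subspaceT.
  - have /ler_normlP[] := lexx `|y - f 0|; move=> h1 h2.
    by rewrite ge_min le_max; apply/andP; split; apply/orP; [left|right]; lra.
  - by move=> t _ <-; exists t.
have [g gK] := choice f_surj.
have fK : cancel f g by move=> t; apply: f_inj; rewrite gK.
exists g; split => // y; rewrite -{1}(gK y).
apply: is_derive_inverse; first by near=> t; exact: fK.
  by near=> t; exact: fC.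
by rewrite gt_eqF// (lt_le_trans c0).
Unshelve. all: by end_near. Qed.

End inverse.

Section plane.
Context {R : realType}.
Local Open Scope classical_set_scope.
Local Open Scope ring_scope.

Definition vec2 (x y : R) : 'rV[R]_2 := \row_i (if i == 0 then x else y).

Lemma vec2_0 x y : vec2 x y 0 0 = x. Proof. by rewrite mxE. Qed.
Lemma vec2_1 x y : vec2 x y 0 1 = y. Proof. by rewrite mxE. Qed.
Definition vec2E := (vec2_0, vec2_1).

Lemma ord2_cases (i : 'I_2) : i = 0 \/ i = 1.
Proof. by case: i => [[|[|//]] p]; [left|right]; exact: val_inj. Qed.

Lemma rV2P (v w : 'rV[R]_2) : v 0 0 = w 0 0 -> v 0 1 = w 0 1 -> v = w.
Proof.
by move=> h0 h1; apply/rowP => i; have [->|->] := ord2_cases i.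
Qed.

Lemma vec2_basis (x y : R) : vec2 x y = x *: vec2 1 0 + y *: vec2 0 1.
Proof. apply: rV2P; rewrite !mxE /=; ring. Qed.

Lemma norm_rV2_le (v : 'rV[R]_2) (e : R) :
  (`|v| <= e) = (`|v 0 0| <= e) && (`|v 0 1| <= e).
Proof.
apply/idP/andP => [ve|[v0 v1]].
  by split; apply: le_trans ve; rewrite /Num.norm/= mx_normrE;
    apply: (le_bigmax _ (fun ij : 'I_1 * 'I_2 => `|v ij.1 ij.2|) (_, _)).
have e0 := le_trans (normr_ge0 _) v0.
rewrite {1}/Num.norm/= mx_normrE; apply: bigmax_le => // [[i j]] _ /=; rewrite ord1.
by have [->|->] := ord2_cases j.
Qed.

Lemma continuous_coord2 i : continuous (fun v : 'rV[R]_2 => v 0 i).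
Proof. exact: coord_continuous. Qed.

Lemma continuous_vec2 (T : topologicalType) (f g : T -> R) (x : T) :
  {for x, continuous f} -> {for x, continuous g} ->
  {for x, continuous (fun y => vec2 (f y) (g y))}.
Proof.
move=> fc gc.
rewrite (_ : (fun y => _) =
    (fun y => f y *: vec2 1 0) + (fun y => g y *: vec2 0 1)); last first.
  by apply/funext => y; rewrite vec2_basis.
by apply: continuousD; apply: continuousZr_tmp.
Qed.

Global Instance is_diff_coord2 (x : 'rV[R]_2) i :
  is_diff x (fun v : 'rV[R]_2 => v 0 i : R) (fun v => v 0 i).
Proof.
have lin : linear (fun v : 'rV[R]_2 => v 0 i : R).
  by move=> a u v; rewrite !mxE.
pose L := GRing.isLinear.Build _ _ _ _ _ lin.
pose f : {linear 'rV[R]_2 -> R} := HB.pack (fun v : 'rV[R]_2 => v 0 i : R) L.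
apply: DiffDef; first exact: differentiable_coord.
by apply: (@diff_lin _ _ _ f); exact: continuous_coord2.
Qed.

Lemma is_diff_comp1 (V : normedModType R) (x : V) (u du : V -> R) (f : R -> R) (c : R) :
  is_diff x u du -> is_derive (u x) 1 f c ->
  is_diff x (f \o u) (fun v => c * du v).
Proof.
move=> uD [fD fE].
have fdiff : is_diff (u x) f (fun h => c * h).
  apply: DiffDef; first exact/derivable1_diffP.
  rewrite deriv1E// derive1E fE; apply/funext => h.
  by rewrite /GRing.scale /= mulrC.
exact: (@is_diff_comp _ _ _ _ u du f _ x uD fdiff).
Qed.

Lemma is_diff_vec2 (V : normedModType R) (x : V) (f g df dg : V -> R) :
  is_diff x f df -> is_diff x g dg ->
  is_diff x (fun y => vec2 (f y) (g y)) (fun v => vec2 (df v) (dg v)).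
Proof.
move=> fD gD.
have Zl (h dh : V -> R) (w : 'rV[R]_2) : is_diff x h dh ->
    is_diff x (fun y => h y *: w) (fun v => dh v *: w).
  move=> hD; have hd : differentiable h x by [].
  apply: DiffDef; first exact: differentiableZl.
  by rewrite diffZl// diff_val.
rewrite (_ : (fun y => _) =
    (fun y => f y *: vec2 1 0) + (fun y => g y *: vec2 0 1)); last first.
  by apply/funext => y; rewrite vec2_basis.
apply: (is_diff_eq (@is_diffD _ _ _ _ _ _ _ _ (Zl _ _ _ fD) (Zl _ _ _ gD))).
by apply/funext => v; rewrite [RHS]vec2_basis.
Qed.

End plane.

(** * Charts of the torus and lifts to the plane *)

Lemma near_continuous (S T : topologicalType) (f g : S -> T) (x : S) :
  (\forall y \near x, f y = g y)%classic ->
  {for x, continuous f}%classic -> {for x, continuous g}%classic.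
Proof.
move=> fg; have fgx := nbhs_singleton fg; rewrite /prop_for /continuous_at -fgx.
by apply: cvg_trans; apply: near_eq_cvg; apply: filterS fg.
Qed.

Section near_is_diff.
Context {R : realType} {V W : normedModType R}.
Local Open Scope classical_set_scope.
Local Open Scope ring_scope.

(** Differentiability is local: the charts of the torus agree with differences of
lifts only near the base point. *)
Lemma near_is_diff (f g : V -> W) (x : V) (df : V -> W) :
  (\forall y \near x, f y = g y) -> is_diff x f df -> is_diff x g df.
Proof.
move=> fg fD; have fd : differentiable f x by [].
have <- : 'd f x = df :> (_ -> _) by exact: diff_val.
have [dc /eqaddoP fo] := (diff_locallyP _ _).1 fd.
have gx : g x = f x by rewrite (nbhs_singleton fg).
have go : g \o shift x = cst (g x) + 'd f x +o_ (0 : V) id.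
  apply/eqaddoP => e e0; have /nbhs0P fg0 := fg.
  apply: filterS2 fg0 (fo e e0) => h; rewrite [x + h]addrC => fgh.
  by rewrite !opprD !addrfctE /= gx -fgh.
have gE := diff_unique dc go.
have gd : differentiable g x by apply/diff_locallyP; rewrite gE.
exact: DiffDef gd gE.
Qed.

End near_is_diff.

Section torus.
Context {R : realType}.
Local Open Scope classical_set_scope.
Local Open Scope ring_scope.
Local Notation V := 'rV[R]_2.
Local Notation T := (torus2 R).

Lemma tpiD (x y : V) : tpi (x + y) = tpi x + tpi y.
Proof. exact: (@Quotient.pi_add _ (Z2_closed R)). Qed.

Lemma tpi0 : tpi (0 : V) = 0.
Proof. by apply: (addrI (tpi (0 : V))); rewrite -tpiD !addr0. Qed.

Lemma tpiN (x : V) : tpi (- x) = - tpi x.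
Proof. by apply: (addrI (tpi x)); rewrite -tpiD !subrr tpi0. Qed.

Lemma tpiB (x y : V) : tpi (x - y) = tpi x - tpi y.
Proof. by rewrite tpiD tpiN. Qed.

Lemma tpi_eq (x y : V) : (x - y \in Z2_closed R) <-> tpi x = tpi y.
Proof.
rewrite Quotient.idealrBE; split => [/eqP|e]; first by [].
exact/eqP.
Qed.

Lemma tpi_repr (z : T) : tpi (repr (z : torus2_quot R)) = z.
Proof. exact: reprK. Qed.

Lemma tpi_surj (z : T) : exists x, z = tpi x.
Proof. by exists (repr (z : torus2_quot R)); rewrite tpi_repr. Qed.

Lemma Z2P (x : V) :
  (x \in Z2_closed R) <-> (x 0 0 \is a Num.int) /\ (x 0 1 \is a Num.int).
Proof.
split => [/mxOverP h|[h0 h1]]; first by split.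
by apply/mxOverP => i j; rewrite ord1; have [->|->] := ord2_cases j.
Qed.

Lemma tlogK (z : T) : tpi (tlog z) = z.
Proof.
rewrite -{2}[z]tpi_repr; apply/tpi_eq/Z2P; rewrite !mxE.
by split; rewrite addrAC subrr sub0r rpredN rpred_int.
Qed.

(** The coordinates of [repr (tpi w)] differ from those of [w] by integers, and
[tlog] removes the integer when they lie in [[-1/2, 1/2[]. *)
Lemma tpiK (w : V) : `|w| < 2^-1 -> tlog (tpi w) = w.
Proof.
move=> w2; have /tpi_eq/Z2P [h0 h1] := tpi_repr (tpi w).
have key (a b : R) : a - b \is a Num.int -> `|b| < 2^-1 ->
    a - (Num.floor (a + 2^-1))%:~R = b.
  case/intrP => n abn; rewrite ltr_norml => /andP[b1 b2].
  have -> : a = b + n%:~R by rewrite -abn addrC subrK.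
  rewrite [b + _ + 2^-1]addrAC floorDrz ?intr_int// intrKfloor rmorphD .
  rewrite (@floor_def _ _ 0); first by rewrite add0r addrK.
  by rewrite add0r; apply/andP; split; lra.
have wb i : `|w 0 i| < 2^-1.
  apply: le_lt_trans w2; rewrite /Num.norm/= mx_normrE.
  by apply: (le_bigmax _ (fun ij : 'I_1 * 'I_2 => `|w ij.1 ij.2|) (_, _)).
by apply: rV2P; rewrite mxE; apply: key => //; move: h0 h1; rewrite !mxE.
Qed.

Lemma continuous_tpi : continuous (@tpi R).
Proof. exact: pi_continuous. Qed.

Lemma torus_continuous (Z : topologicalType) (f : T -> Z) :
  continuous (f \o @tpi R) -> continuous f.
Proof. by move=> h; apply/quotient_continuous. Qed.

Definition lifts (f : T -> T) (F : V -> V) := forall x, f (tpi x) = tpi (F x).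

Lemma lifts_continuous f F : lifts f F -> continuous F -> continuous f.
Proof.
move=> fF Fc; apply: torus_continuous.
rewrite (_ : f \o _ = @tpi R \o F); last by apply/funext => x /=; exact: fF.
by move=> x; apply: continuous_comp; [exact: Fc|exact: continuous_tpi].
Qed.

Lemma lifts_iter f F n : lifts f F -> lifts (iter n f) (iter n F).
Proof. by move=> fF; elim: n => [|n IH] x //=; rewrite IH fF. Qed.

Lemma in_chart_lifts f F x v : lifts f F ->
  in_chart f (tpi x) v = tlog (tpi (F (x + v) - F x)).
Proof. by move=> fF; rewrite /in_chart -tpiD !fF tpiB. Qed.

(** In the charts, [f] is [fun v => F (x + v) - F x] as long as the latter stays in
the fundamental square. *)
Lemma is_diff_in_chart f F x v dF : lifts f F -> `|F (x + v) - F x| < 2^-1 ->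
  is_diff (x + v) F dF -> is_diff v (in_chart f (tpi x)) dF.
Proof.
move=> fF Fv FD.
have S : is_diff v (fun w => x + w) id.
  rewrite (_ : (fun w => _) = cst x + id); last exact/funext.
  apply: (is_diff_eq (@is_diffD _ _ _ _ _ _ _ v (is_diff_cst x v) (is_diff_id v))).
  by apply/funext => w; rewrite addrfctE /= add0r.
have D : is_diff v ((fun y => F y - F x) \o (fun w => x + w)) dF.
  apply: (@is_diff_comp _ _ _ _ _ id _ dF); last first.
  rewrite (_ : (fun y => _) = F - cst (F x)); last exact/funext.
  apply: (is_diff_eq (@is_diffB _ _ _ _ _ _ _ _ FD (is_diff_cst (F x) _))).
  by apply/funext => w; rewrite !fctE subr0.
apply: (near_is_diff _ D); have : {for v, continuous (fun w => F (x + w) - F x)}.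
  by case: D => dd _; exact: (differentiable_continuous dd).
move=> /(@cvgr_norm_lt _ _ _ _ _) /(_ _ Fv); apply: filterS => w Fw.
by rewrite (in_chart_lifts _ _ fF) tpiK.
Qed.

Lemma tangent_lifts f F x dF : lifts f F -> is_diff x F dF ->
  tangent f (tpi x) = dF.
Proof.
move=> fF FD; have : is_diff 0 (in_chart f (tpi x)) dF.
  by apply: (is_diff_in_chart fF); rewrite addr0// subrr normr0 invr_gt0.
by move=> D; rewrite /tangent diff_val.
Qed.

Lemma Cr1_lifts f F (dF : V -> V -> V) : lifts f F ->
  (forall x, is_diff x F (dF x)) -> (forall v, continuous (dF ^~ v)) -> Cr 1 f.
Proof.
move=> fF FD dFc p; have [x ->] := tpi_surj p.
have Fc : continuous F by move=> y; apply: differentiable_continuous.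
have sc : continuous (fun v => F (x + v) - F x).
  move=> v; apply: continuousB; last exact: cst_continuous.
  apply: (@continuous_comp _ _ _ (fun v => x + v)); last exact: Fc.
  by apply: continuousD => //; exact: cst_continuous.
pose U := [set v | `|F (x + v) - F x| < 2^-1].
have Uo : open U.
  rewrite (_ : U = (fun v => `|F (x + v) - F x|) @^-1` [set r | r < 2^-1]) //.
  apply: open_comp; last exact: open_lt.
  by move=> u _; apply: continuous_comp; [exact: sc|exact: norm_continuous].
have D v : U v -> is_diff v (in_chart f (tpi x)) (dF (x + v)).
  by move=> Uv; exact: (is_diff_in_chart fF).
exists U; split => //; first by rewrite /U /= addr0 subrr normr0 invr_gt0.
split => [v Uv|w v Uv]; first by have := D v Uv.
have c : {for v, continuous (fun u => dF (x + u) w)}.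
  apply: (@continuous_comp _ _ _ (fun v => x + v) (dF^~ w)); last exact: dFc.
  by apply: continuousD => //; exact: cst_continuous.
have E u : U u -> 'd (in_chart f (tpi x)) u w = dF (x + u) w.
  by move=> /D Du; rewrite diff_val.
apply: (near_continuous _ c); have : nbhs v U by apply: open_nbhs_nbhs.
by apply: filterS => u /E.
Qed.

Definition descend (F : V -> V) : T -> T :=
  fun z => tpi (F (repr (z : torus2_quot R))).

Lemma descend_lifts F :
  (forall x y, x - y \in Z2_closed R -> F x - F y \in Z2_closed R) ->
  lifts (descend F) F.
Proof. by move=> FZ x; apply/tpi_eq/FZ/tpi_eq; rewrite tpi_repr. Qed.

End torus.

(** * Affine equations over a dynamical system *)

Section cohomological.
Context {R : realType} {X : topologicalType}.
Local Open Scope classical_set_scope.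
Local Open Scope ring_scope.

Lemma geometric_small (C q e : R) : 0 <= q < 1 -> 0 < e ->
  exists n, C * q ^+ n < e.
Proof.
move=> /andP[q0 q1] e0; have q1' : `|q| < 1 by rewrite ger0_norm.
have /cvgrPdist_lt /(_ e e0) := cvg_geometric C q1'.
case=> n _ /(_ n (leqnn n)); rewrite /= sub0r normrN => h.
by exists n; apply: le_lt_trans h; rewrite ler_norm.
Qed.

(** The right-hand side contracts bounded functions by [q], and its iterates
[A n] from 0 are continuous and uniformly Cauchy. The limit is taken as the
supremum of the lower bounds [A n x - C * q ^+ n]. *)
Lemma affine_cocycle_solution (f : X -> X) (al be : X -> R) (K q : R) :
  continuous f -> continuous al -> continuous be ->
  0 <= q < 1 -> (forall x, `|al x| <= K) -> (forall x, `|be x| <= q) ->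
  exists a : X -> R, [/\ continuous a, forall x, `|a x| <= K / (1 - q) &
    forall x, a x = al x + be x * a (f x)].
Proof.
move=> fc alc bec q01 alK beq; have /andP[q0 q1] := q01.
set C := K / (1 - q).
have CE : C = K + q * C by rewrite /C; field; rewrite subr_eq0 gt_eqF.
pose A := fix A n x := if n is m.+1 then al x + be x * A m (f x) else 0.
have AS n x : A n.+1 x = al x + be x * A n (f x) by [].
have Ac n : continuous (A n).
  elim: n => [|n IH] x; first exact: cst_continuous.
  have -> : A n.+1 = al + be * (A n \o f) by [].
  apply: (@continuousD R R); first exact: alc.
  apply: (@continuousM R); first exact: bec.
  exact: (continuous_comp (fc x) (IH (f x))).
have contr (b M : R) x : `|b| <= M -> `|be x * b| <= q * M.
  by move=> bM; rewrite normrM ler_pM.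
have Ab n x : `|A n x| <= C.
  elim: n x => [|n IH] x /=.
    have K0 : 0 <= K := le_trans (normr_ge0 _) (alK x).
    by rewrite normr0 /C divr_ge0// subr_ge0 ltW.
  by rewrite CE (le_trans (ler_normD _ _))// lerD// contr.
have AA n k x : `|A (n + k)%N x - A n x| <= C * q ^+ n.
  elim: n x => [|n IH] x; first by rewrite subr0 expr0 mulr1.
  by rewrite addSn !AS opprD addrACA subrr add0r -mulrBr exprS mulrCA contr.
have sep m n x : A m x - C * q ^+ m <= A n x + C * q ^+ n.
  have C0 k : 0 <= C * q ^+ k.
    by rewrite mulr_ge0 ?exprn_ge0//; exact: le_trans (Ab 0%N x).
  case: (leqP m n) => [mn|/ltnW nm].
    have := AA m (n - m)%N x; rewrite subnKC// => /ler_normlP[].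
    by have := C0 n; lra.
  have := AA n (m - n)%N x; rewrite subnKC// => /ler_normlP[].
  by have := C0 m; lra.
pose a x := sup [set A n x - C * q ^+ n | n in setT].
have aA n x : `|a x - A n x| <= C * q ^+ n.
  have ub : ubound [set A n x - C * q ^+ n | n in setT] (A n x + C * q ^+ n).
    by move=> _ [m _ <-].
  apply/ler_normlP; split.
    have : A n x - C * q ^+ n <= a x.
      apply: ub_le_sup; last by exists n.
      by exists (A n x + C * q ^+ n).
    by lra.
  have : a x <= A n x + C * q ^+ n.
    by apply: ge_sup => //; exists (A n x - C * q ^+ n); exists n.
  by lra.
exists a; split => [x|x|x].
- apply/cvgrPdist_lt => e e0.
  have [n Cn] := @geometric_small C q (e / 3) q01 (divr_gt0 e0 (ltr0Sn _ 2)).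
  have /cvgrPdist_lt/(_ _ (divr_gt0 e0 (ltr0Sn _ 2))) := Ac n x.
  apply: filterS => y; have := aA n x; have := aA n y.
  move=> /ler_normlP[y1 y2] /ler_normlP[x1 x2]; rewrite !ltr_norml.
  by move=> /andP[h1 h2]; apply/andP; split; lra.
- by have := aA 0%N x; rewrite subr0 expr0 mulr1.
- apply/eqP; rewrite -subr_eq0 -normr_le0; apply/ler_addgt0Pl => e e0.
  have [n Cn] := @geometric_small C q (e / 2) q01 (divr_gt0 e0 (ltr0Sn _ 1)).
  have := contr _ _ x (aA n (f x)); have := aA n.+1 x; rewrite AS exprS.
  have : q * (C * q ^+ n) <= C * q ^+ n.
    by rewrite ler_piMl ?(ltW q1)// (le_trans _ (aA n x)).
  rewrite mulrCA mulrBr => q2 /ler_normlP[x1 x2] /ler_normlP[y1 y2].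
  by rewrite addr0; apply/ler_normlP; split; lra.
Qed.

End cohomological.

(** * The perturbed automorphism and its inverse *)

Section lambda.
Context {R : realType}.
Local Open Scope ring_scope.

(** The eigenvalues of (2 1; 1 0) are [lam] and [- lam^-1 = 2 - lam]. *)
Definition lam : R := 1 + Num.sqrt 2.

Lemma lam_sqr : lam ^+ 2 = 2 * lam + 1.
Proof.
by rewrite /lam sqrrD sqr_sqrtr ?ler0n// expr1n mul1r mulr2n; ring.
Qed.

Lemma lam_bounds : 2 < lam < 5 / 2.
Proof.
have s0 : 0 <= Num.sqrt (2 : R) by rewrite sqrtr_ge0.
have s2 : Num.sqrt (2 : R) ^+ 2 = 2 by rewrite sqr_sqrtr.
by rewrite /lam; apply/andP; split; nra.
Qed.

End lambda.

Section cat_map.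
Context {R : realType}.
Local Open Scope classical_set_scope.
Local Open Scope ring_scope.
Local Notation V := 'rV[R]_2.
Local Notation T := (torus2 R).
Local Notation lam := (@lam R).

Definition eu : V := vec2 lam 1.
Definition es : V := vec2 1 (- lam).

(** [cu] and [cs] are the coordinates in the orthogonal eigenbasis [eu], [es]. *)
Definition cu (v : V) : R := (lam * v 0 0 + v 0 1) / (1 + lam ^+ 2).
Definition cs (v : V) : R := (v 0 0 - lam * v 0 1) / (1 + lam ^+ 2).

Lemma eigen_decomposition v : v = cs v *: es + cu v *: eu.
Proof.
have /andP[l2 _] := @lam_bounds R.
by apply: rV2P; rewrite !mxE /= /cs /cu; field; rewrite gt_eqF//; nra.
Qed.

Lemma cs_es_eu a b : cs (a *: es + b *: eu) = a.
Proof.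
have /andP[l2 _] := @lam_bounds R.
by rewrite /cs !mxE /=; field; rewrite gt_eqF//; nra.
Qed.

Lemma cu_es_eu a b : cu (a *: es + b *: eu) = b.
Proof.
have /andP[l2 _] := @lam_bounds R.
by rewrite /cu !mxE /=; field; rewrite gt_eqF//; nra.
Qed.

Lemma cs_le v : `|cs v| <= `|v|.
Proof.
have /andP[l2 _] := @lam_bounds R.
have := lexx `|v|; rewrite {1}norm_rV2_le => /andP[/ler_normlP[a b] /ler_normlP[c d]].
have D0 : 0 < 1 + lam ^+ 2 by nra.
set m := `|v| in a b c d *; have m0 : 0 <= m by rewrite /m.
have h1 : lam * v 0 1 <= lam * m by rewrite ler_wpM2l//; lra.
have h2 : lam * - v 0 1 <= lam * m by rewrite ler_wpM2l//; lra.
have h3 : lam * m <= m * lam ^+ 2 by rewrite mulrC ler_wpM2l//; nra.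
rewrite /cs normrM normfV (gtr0_norm D0) ler_pdivrMr// mulrDr mulr1.
by apply/ler_normlP; split; lra.
Qed.

(** This is [x |-> L x + psi (x 0 1) *: eu], for [L] of matrix (2 1; 1 0). *)
Definition Fcat (x : V) : V :=
  vec2 (2 * x 0 0 + x 0 1 + lam * psi (x 0 1)) (x 0 0 + psi (x 0 1)).

Definition dFcat (x v : V) : V :=
  vec2 (2 * v 0 0 + v 0 1 + lam * (dpsi (x 0 1) * v 0 1))
       (v 0 0 + dpsi (x 0 1) * v 0 1).

Lemma is_diff_Fcat x : is_diff x Fcat (dFcat x).
Proof.
have P : is_diff x (@psi R \o (fun v : V => v 0 1))
    (fun v => dpsi (x 0 1) * v 0 1).
  exact: (is_diff_comp1 (is_diff_coord2 x 1) (is_derive_psi _)).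
by apply: is_diff_vec2.
Qed.

Lemma continuous_dFcat v : continuous (dFcat ^~ v).
Proof.
move=> x.
have c : {for x, continuous (fun x : V => dpsi (x 0 1) * v 0 1)}.
  apply: continuousM; last exact: cst_continuous.
  apply: (@continuous_comp _ _ _ (fun x : V => x 0 1) (@dpsi R)).
    exact: continuous_coord2.
  exact: continuous_dpsi.
apply: (@continuous_vec2 _ _
  (fun x : V => 2 * v 0 0 + v 0 1 + lam * (dpsi (x 0 1) * v 0 1))
  (fun x : V => v 0 0 + dpsi (x 0 1) * v 0 1)).
  apply: continuousD; first exact: cst_continuous.
  by apply: continuousM => //; exact: cst_continuous.
by apply: continuousD => //; exact: cst_continuous.
Qed.

Definition Phi (t : R) : R := lam * t + psi t.

Lemma is_derive_Phi (t : R) : is_derive t 1 Phi (lam + dpsi t).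
Proof.
have P := is_derive_psi t.
have -> : Phi = lam *: id + @psi R by [].
by apply: is_derive_eq; rewrite /GRing.scale /= mulr1.
Qed.

Lemma dPhi_ge t : 3 / 2 <= lam + dpsi t.
Proof.
have /andP[l2 _] := @lam_bounds R.
by have /ler_normlP[] := dpsi_bound t; lra.
Qed.

(** If [y = Fcat x], then [lam * (y 0 0 - 2 * y 0 1) = Phi (x 0 1)] because
[lam ^+ 2 = 2 * lam + 1]; this recovers [x 0 1], and then [x 0 0]. *)
Definition Gcat (theta : R -> R) (y : V) : V :=
  let t := theta (lam * (y 0 0 - 2 * y 0 1)) in vec2 (y 0 1 - psi t) t.

Lemma FcatK theta : cancel Phi theta -> cancel Fcat (Gcat theta).
Proof.
move=> PhiK x; rewrite /Gcat /Fcat !vec2E.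
have -> : lam * (2 * x 0 0 + x 0 1 + lam * psi (x 0 1) -
    2 * (x 0 0 + psi (x 0 1))) = Phi (x 0 1).
  have l2 := @lam_sqr R; rewrite /Phi.
  have : psi (x 0 1) * lam ^+ 2 = psi (x 0 1) * (2 * lam + 1) by rewrite l2.
  by lra.
by rewrite PhiK; apply: rV2P; rewrite !vec2E ?addrK.
Qed.

Lemma GcatK theta : cancel theta Phi -> cancel (Gcat theta) Fcat.
Proof.
move=> thetaK y; rewrite /Gcat /Fcat !vec2E.
set t := theta _.
have tE : Phi t = lam * (y 0 0 - 2 * y 0 1) by rewrite /t thetaK.
have /andP[l2 _] := @lam_bounds R.
apply: rV2P; rewrite !vec2E; last by rewrite subrK.
have l0 : lam != 0 by rewrite gt_eqF//; lra.
apply: (mulfI l0); have : psi t * lam ^+ 2 = psi t * (2 * lam + 1).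
  by rewrite lam_sqr.
by move: tE; rewrite /Phi; lra.
Qed.

Lemma Fcat_Z2 x y : x - y \in Z2_closed R -> Fcat x - Fcat y \in Z2_closed R.
Proof.
move=> /Z2P; rewrite !mxE => -[/intrP[m mE] /intrP[n nE]].
have p : psi (x 0 1) = psi (y 0 1).
  have -> : x 0 1 = y 0 1 + n%:~R by rewrite -nE; ring.
  exact: psi_period.
apply/Z2P; rewrite !mxE /= p; split.
  rewrite (_ : _ - _ = 2 * m%:~R + n%:~R) ?rpredD ?rpredM ?rpred_int ?rpred_nat//.
  by rewrite -mE -nE; ring.
by rewrite (_ : _ - _ = m%:~R) ?rpred_int// -mE; ring.
Qed.

(** [m] is the preimage of the integer vector [x - y] by the linear part, which is
unimodular. *)
Lemma Gcat_Z2 theta x y : cancel Phi theta -> cancel theta Phi ->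
  x - y \in Z2_closed R -> Gcat theta x - Gcat theta y \in Z2_closed R.
Proof.
move=> PhiK thetaK /Z2P[]; rewrite !mxE => n0 n1.
pose m : V := vec2 (x 0 1 - y 0 1) (x 0 0 - y 0 0 - 2 * (x 0 1 - y 0 1)).
have mZ : m \in Z2_closed R.
  by apply/Z2P; rewrite !mxE /=; split => //; rewrite rpredB// rpredM// rpred_nat.
have /Z2P[_ /intrP[n nE]] := mZ.
set b := Gcat theta y.
have p : psi ((b + m) 0 1) = psi (b 0 1) by rewrite mxE nE psi_period.
have Fbm : Fcat (b + m) = x.
  have yE : Fcat b = y by rewrite GcatK.
  have y0 : y 0 0 = 2 * b 0 0 + b 0 1 + lam * psi (b 0 1) by rewrite -yE vec2E.
  have y1 : y 0 1 = b 0 0 + psi (b 0 1) by rewrite -yE vec2E.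
  clearbody b; apply: rV2P; rewrite /Fcat p !mxE /=; lra.
by rewrite -Fbm FcatK// addrC addKr.
Qed.

Lemma is_diff_Gcat theta :
  (forall y : R, is_derive y 1 theta (lam + dpsi (theta y))^-1) ->
  exists dG : V -> V -> V, (forall y, is_diff y (Gcat theta) (dG y)) /\
    (forall v, continuous (dG ^~ v)).
Proof.
move=> thetaD.
pose l (y : V) : R := lam * (y 0 0 - 2 * y 0 1).
have lD y : is_diff y l l.
  have D := @is_diffZ _ _ _ _ _ lam y (@is_diffB _ _ _ _ _ _ _ y
    (is_diff_coord2 y 0) (@is_diffZ _ _ _ _ _ 2 y (is_diff_coord2 y 1))).
  exact: D.
pose c y := (lam + dpsi (theta (l y)))^-1.
have tD y : is_diff y (theta \o l) (fun v => c y * l v).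
  exact: (is_diff_comp1 (lD y) (thetaD _)).
have pD y : is_diff y (@psi R \o (theta \o l)) 
    (fun v => dpsi (theta (l y)) * (c y * l v)).
  exact: (is_diff_comp1 (tD y) (is_derive_psi _)).
exists (fun y v : V => vec2 (v 0 1 - dpsi (theta (l y)) * (c y * l v)) (c y * l v)).
split=> [y|v y].
  exact: is_diff_vec2.
have dc : {for y, continuous (fun y => dpsi (theta (l y)))}.
  apply: (@continuous_comp _ _ _ (theta \o l) (@dpsi R)); last exact: continuous_dpsi.
  by have [d _] := tD y; exact: differentiable_continuous d.
have cc : {for y, continuous c}.
  apply: continuousV; first by rewrite gt_eqF// (lt_le_trans _ (dPhi_ge _)).
  by apply: continuousD => //; exact: cst_continuous.
have cl : {for y, continuous (fun y => c y * l v)}.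
  by apply: continuousM => //; exact: cst_continuous.
apply: (@continuous_vec2 _ _
  (fun y => v 0 1 - dpsi (theta (l y)) * (c y * l v))) => //.
apply: continuousB; first exact: cst_continuous.
exact: continuousM.
Qed.

End cat_map.

(** * The Anosov splitting *)

Section anosov_example.
Context {R : realType}.
Local Open Scope classical_set_scope.
Local Open Scope ring_scope.
Local Notation V := 'rV[R]_2.
Local Notation T := (torus2 R).
Local Notation lam := (@lam R).
Local Notation eu := (@eu R).
Local Notation es := (@es R).

Definition fcat : T -> T := descend (@Fcat R).

Lemma fcat_lifts : lifts fcat (@Fcat R).
Proof. by apply: descend_lifts => x y; exact: Fcat_Z2. Qed.

Lemma continuous_fcat : continuous fcat.
Proof.
apply: (lifts_continuous fcat_lifts) => x.
by case: (is_diff_Fcat x) => d _; exact: differentiable_continuous d.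
Qed.

Lemma diffeo_fcat : exists k, diffeo 1 fcat k.
Proof.
have c0 : (0 : R) < 3 / 2 by lra.
have [th [PhiK thK thD]] := derivable_inverse c0 (@is_derive_Phi R) (@dPhi_ge R).
have kG : lifts (descend (Gcat th)) (Gcat th).
  by apply: descend_lifts => x y; exact: Gcat_Z2.
have [dG [GD Gc]] := is_diff_Gcat thD.
exists (descend (Gcat th)); split.
- by move=> z; have [x ->] := tpi_surj z; rewrite fcat_lifts kG FcatK.
- by move=> z; have [x ->] := tpi_surj z; rewrite kG fcat_lifts GcatK.
- exact: (Cr1_lifts fcat_lifts (@is_diff_Fcat R) (@continuous_dFcat R)).
- exact: (Cr1_lifts kG GD Gc).
Qed.

Lemma tangent_fcat x : tangent fcat (tpi x) = dFcat x.
Proof. exact: (tangent_lifts fcat_lifts (is_diff_Fcat x)). Qed.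

Lemma tangent_iter_fcat n p :
  tangent (iter n.+1 fcat) p =
    tangent fcat (iter n fcat p) \o tangent (iter n fcat) p.
Proof.
have [x ->] := tpi_surj p.
pose D := fix D n v := if n is m.+1 then dFcat (iter m (@Fcat R) x) (D m v) else v.
have DD m : is_diff x (iter m (@Fcat R)) (D m).
  elim: m => [|m IH] /=; first exact: is_diff_id.
  exact: (@is_diff_comp _ _ _ _ _ (D m) _ _ x IH (is_diff_Fcat _)).
have tE m : tangent (iter m fcat) (tpi x) = D m.
  exact: (tangent_lifts (lifts_iter m fcat_lifts) (DD m)).
by rewrite !tE (lifts_iter n fcat_lifts) tangent_fcat.
Qed.

Lemma tangent_iter0 p : tangent (iter 0 fcat) p = id.
Proof.
have [x ->] := tpi_surj p.
exact: (tangent_lifts (lifts_iter 0 fcat_lifts) (is_diff_id x)).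
Qed.

Lemma tangentZ (f : T -> T) p a v : tangent f p (a *: v) = a *: tangent f p v.
Proof. exact: linearZ. Qed.

(** By periodicity the choice of a representative is immaterial, see [slope_tpi]. *)
Definition slope (z : T) : R := dpsi (repr (z : torus2_quot R) 0 1).

Lemma slope_tpi x : slope (tpi x) = dpsi (x 0 1).
Proof.
rewrite /slope; have /tpi_eq/Z2P[_ /intrP[n]] := tpi_repr (tpi x).
rewrite !mxE => nE; set r := repr _ in nE *.
have -> : r 0 1 = x 0 1 + n%:~R by rewrite -nE; ring.
exact: dpsi_period.
Qed.

Lemma continuous_slope : continuous slope.
Proof.
apply: torus_continuous.
have -> : slope \o tpi (R := R) = @dpsi R \o (fun x : V => x 0 1).
  by apply/funext => x; exact: slope_tpi.
move=> x; apply: continuous_comp; first exact: continuous_coord2.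
exact: continuous_dpsi.
Qed.

Lemma slope_bound z : `|slope z| <= 2^-1.
Proof. exact: dpsi_bound. Qed.

Lemma tangent_fcat_eu p : tangent fcat p eu = (lam + slope p) *: eu.
Proof.
have [x ->] := tpi_surj p; rewrite tangent_fcat slope_tpi.
have l2 := @lam_sqr R; apply: rV2P; rewrite !mxE /=; last by ring.
by have : lam ^+ 2 = 2 * lam + 1 := l2; lra.
Qed.

Lemma tangent_fcat_es p :
  tangent fcat p es = (2 - lam) *: es - (lam * slope p) *: eu.
Proof.
have [x ->] := tpi_surj p; rewrite tangent_fcat slope_tpi.
have l2 := @lam_sqr R; apply: rV2P; rewrite !mxE /=; first by ring.
by have : lam ^+ 2 = 2 * lam + 1 := l2; lra.
Qed.

(** The line spanned by [es + a p *: eu] is invariant exactly when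
[a p * (lam + slope p) = lam * slope p + (2 - lam) * a (fcat p)]. Solved for [a p],
this contracts by [(lam - 2) / (lam + slope p) <= 1 / 3]. *)
Lemma stable_slope : exists a : T -> R, [/\ continuous a,
  forall p, `|a p| <= 3 / 2 &
  forall p, tangent fcat p (es + a p *: eu) = (2 - lam) *: (es + a (fcat p) *: eu)].
Proof.
have /andP[l2 l3] := @lam_bounds R.
have D z : 3 / 2 <= lam + slope z by exact: dPhi_ge.
have Dc : continuous (fun z => (lam + slope z)^-1).
  move=> z; apply: (@continuousV R T (fun z => lam + slope z)).
    by rewrite gt_eqF// (lt_le_trans _ (D z)).
  by apply: (@continuousD R R T); [exact: cst_continuous|exact: continuous_slope].
have [] := @affine_cocycle_solution R T fcat
  (fun z => lam * slope z * (lam + slope z)^-1)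
  (fun z => (2 - lam) * (lam + slope z)^-1) 1 (1 / 3) continuous_fcat.
- move=> z; apply: (@continuousM R T); last exact: Dc.
  by apply: (@continuousM R T); [exact: cst_continuous|exact: continuous_slope].
- by move=> z; apply: (@continuousM R T); [exact: cst_continuous|exact: Dc].
- by apply/andP; split; lra.
- move=> z; have D0 : 0 < lam + slope z by rewrite (lt_le_trans _ (D z)).
  rewrite normrM normfV (gtr0_norm D0) ler_pdivrMr// mul1r.
  have /ler_normlP[s1 s2] := slope_bound z.
  have h1 : 0 <= (2^-1 - slope z) * (lam - 1) by apply: mulr_ge0; lra.
  have h2 : 0 <= (2^-1 + slope z) * (lam + 1) by apply: mulr_ge0; lra.
  by apply/ler_normlP; split; lra.
- move=> z; have D0 : 0 < lam + slope z by rewrite (lt_le_trans _ (D z)).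
  rewrite normrM normfV (gtr0_norm D0) ler_pdivrMr//.
  by have := D z; rewrite ler0_norm; lra.
move=> a [ac ab aE]; exists a; split => //.
  have e : 1 / (1 - 1 / 3) = 3 / 2 :> R by field.
  by move=> p; rewrite -e.
move=> p; have D0 : lam + slope p != 0 by rewrite gt_eqF// (lt_le_trans _ (D p)).
have aE' : a p * (lam + slope p) = lam * slope p + (2 - lam) * a (fcat p).
  by rewrite (aE p); field.
have -> : tangent fcat p (es + a p *: eu) =
    tangent fcat p es + a p *: tangent fcat p eu.
  by rewrite /tangent linearD linearZ.
rewrite tangent_fcat_es tangent_fcat_eu scalerA aE' scalerDr -addrA; congr (_ + _).
by rewrite -scaleNr -scalerDl scalerA; congr (_ *: _); ring.
Qed.

Lemma vline_scale (k : R) (v : V) : k != 0 -> (<[k *: v]> = <[v]>)%VS.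
Proof.
move=> k0; apply/eqP; rewrite eqEsubv -!memvE; apply/andP; split.
  by rewrite memvZ ?memv_line.
by rewrite -{1}[v]scale1r -(mulVf k0) -scalerA memvZ ?memv_line.
Qed.

Lemma invariant_line (f : T -> T) (w : T -> V) (k : T -> R) :
  (forall p, k p != 0) -> (forall p, tangent f p (w p) = k p *: w (f p)) ->
  invariant_field f (fun p => <[w p]>%VS).
Proof.
move=> k0 fw p; rewrite limg_line.
have -> : linfun (tangent f p) (w p) = tangent f p (w p) by exact: lfunE.
by rewrite fw vline_scale.
Qed.

(** The stable vectors [w p] are multiplied by exactly [2 - lam], and [eu] by
[lam + slope p >= 3 / 2], so both rates are read off without estimates on the
splitting. *)
Lemma anosov_fcat : anosov R 1 fcat.
Proof.
have /andP[l2 l3] := @lam_bounds R.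
split; first exact: diffeo_fcat.
have [a [ac ab aE]] := stable_slope.
pose w p := es + a p *: eu.
have decomp p v : v = cs v *: w p + (cu v - cs v * a p) *: eu.
  by rewrite {1}[v]eigen_decomposition /w; apply: rV2P; rewrite !mxE; ring.
have cs_w p c d : cs (c *: w p + d *: eu) = c.
  by rewrite /w scalerDr scalerA -addrA -scalerDl cs_es_eu.
have cap p : (<[w p]> :&: <[eu]> = 0)%VS.
  apply/eqP; rewrite -subv0; apply/subvP => v; rewrite memv_cap.
  case/andP => /vlineP[c vc] /vlineP[d vd].
  have c0 : c = 0.
    have : cs (c *: w p + 0 *: eu) = cs (0 *: w p + d *: eu).
      by rewrite !scale0r add0r addr0 -vc -vd.
    by rewrite !cs_w.
  by rewrite vc c0 scale0r mem0v.
have full p : (<[w p]> + <[eu]> = fullv)%VS.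
  apply/eqP; rewrite eqEsubv subvf /=; apply/subvP => v _; rewrite (decomp p v).
  by apply: memv_add; rewrite memvZ ?memv_line.
have pis p v : daddv_pi <[w p]>%VS <[eu]>%VS v = cs v *: w p.
  rewrite {1}(decomp p v) linearD !linearZ /= (daddv_pi_id (cap p)) ?memv_line//.
  suff -> : daddv_pi <[w p]>%VS <[eu]>%VS eu = 0 by rewrite scaler0 addr0.
  have := @daddv_pi_add _ _ <[w p]>%VS <[eu]>%VS eu (cap p).
  rewrite full memvf => /(_ isT).
  rewrite (@daddv_pi_id _ _ <[eu]>%VS) ?memv_line//; last first.
    by rewrite capvC cap.
  by move=> h; apply: (addIr eu); rewrite h add0r.
have piu p v : daddv_pi <[eu]>%VS <[w p]>%VS v = v - cs v *: w p.
  have := @daddv_pi_add _ _ <[w p]>%VS <[eu]>%VS v (cap p).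
  by rewrite full memvf => /(_ isT); rewrite pis => h; rewrite -{2}h addrC addKr.
have wc : continuous w.
  move=> p; apply: (@continuousD R V T (cst es) (fun p => a p *: eu)).
    exact: cst_continuous.
  by apply: continuousZr_tmp; exact: ac.
exists (fun p => <[w p]>%VS), (fun _ => <[eu]>%VS); split.
- split => // v p.
    rewrite (_ : (fun p => _) = fun p => cs v *: w p); last first.
      by apply/funext => q; rewrite pis.
    by apply: continuousZl_tmp; exact: wc.
  rewrite (_ : (fun p => _) = fun p => v - cs v *: w p); last first.
    by apply/funext => q; rewrite piu.
  apply: (@continuousB R V T (cst v) (fun p => cs v *: w p)).
    exact: cst_continuous.
  by apply: continuousZl_tmp; exact: wc.
- apply: (@invariant_line _ _ (fun=> 2 - lam)) => [p|p]; last exact: aE.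
  by rewrite lt_eqF//; lra.
- apply: (@invariant_line _ (fun=> eu) (fun p => lam + slope p)) => p.
    by rewrite gt_eqF// (lt_le_trans _ (dPhi_ge _)).
  exact: tangent_fcat_eu.
- pose M : R := `|es| + 3 / 2 * `|eu| + 1.
  have M0 : 0 < M by rewrite ltr_wpDl// addr_ge0// mulr_ge0//; lra.
  have wM p : `|w p| <= M.
    rewrite (le_trans (ler_normD _ _))// normrZ /M.
    have : `|a p| * `|eu| <= 3 / 2 * `|eu| by rewrite ler_wpM2r.
    by lra.
  have tw n p : tangent (iter n fcat) p (w p) = (2 - lam) ^+ n *: w (iter n fcat p).
    elim: n => [|n IH]; first by rewrite tangent_iter0 expr0 scale1r.
    by rewrite tangent_iter_fcat /= IH tangentZ aE scalerA exprSr.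
  exists M, (lam - 2); split => //; first by apply/andP; split; lra.
  move=> n p v /vlineP[c vE].
  have c_le : `|c| <= `|v|.
    by have := cs_le v; rewrite {1}vE -[c *: w p]addr0 -(scale0r eu) cs_w.
  have n2 : `|2 - lam| = lam - 2 by rewrite ler0_norm ?opprB//; lra.
  rewrite {1}vE tangentZ tw !normrZ normrX n2.
  rewrite mulrCA [M * _]mulrC -mulrA.
  have rn : 0 <= (lam - 2) ^+ n by rewrite exprn_ge0// subr_ge0 ltW.
  by apply: ler_wpM2l => //; rewrite [leRHS]mulrC ler_pM.
- have tu n p : exists2 r, (3 / 2) ^+ n <= r & tangent (iter n fcat) p eu = r *: eu.
    elim: n => [|n [r rn IH]]; first by
      exists 1; rewrite ?tangent_iter0 ?scale1r// expr0.
    exists (r * (lam + slope (iter n fcat p))).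
      by rewrite exprSr ler_pM ?exprn_ge0// ?dPhi_ge//; lra.
    by rewrite tangent_iter_fcat /= IH tangentZ tangent_fcat_eu scalerA.
  exists 1, (2 / 3); split => //; first by apply/andP; split; lra.
  move=> n p v /vlineP[c vE]; have [r rn tE] := tu n p.
  rewrite vE tangentZ tE !normrZ mul1r mulrCA.
  apply: ler_wpM2l => //; rewrite mulrA ler_peMl//.
  have : (3 / 2) ^+ n <= `|r| := le_trans rn (ler_norm r).
  move/(ler_wpM2l (_ : 0 <= (2 / 3 : R) ^+ n)) => h; apply: le_trans (h _).
    by rewrite -exprMn (_ : 2 / 3 * (3 / 2) = 1) ?expr1n//; field.
  by rewrite exprn_ge0//; lra.
Qed.

End anosov_example.

(** * Two sequence lemmas *)

Section sequences.
Context {R : realType}.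
Local Open Scope classical_set_scope.
Local Open Scope ring_scope.

Lemma harmonic_unbounded (B : R) : exists n, B < series harmonic n.
Proof.
apply: contrapT => nB; apply: (@dvg_harmonic R); apply: nondecreasing_is_cvgn.
  apply/nondecreasing_seqP => n; rewrite /series /= big_nat_recr//= lerDl.
  by rewrite invr_ge0.
exists B => _ [n _ <-]; rewrite leNgt; apply/negP => h; apply: nB.
by exists n.
Qed.

(** Suppose that [z n = l ^+ n * t n] is bounded below. Then [- ln (t n)] grows at
most linearly in [n], so the recursion makes [z n] drop by a fixed multiple of
[harmonic n] at each step, which is impossible for a positive sequence. *)
Lemma slow_profile_forces_decay (l c0 : R) (t : R^nat) : 1 < l -> 0 < c0 ->
  (forall n, 0 < t n < 1) ->
  (forall n, l * t n.+1 + t n.+1 / (c0 * (4 - 2 * ln (t n.+1))) <= t n) ->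
  forall kappa, 0 < kappa -> exists n, l ^+ n * t n < kappa.
Proof.
move=> l1 c00 t01 tS kappa k0; apply: contrapT => nk.
have zk n : kappa <= l ^+ n * t n.
  by rewrite leNgt; apply/negP => h; apply: nk; exists n.
have l0 : 0 < l by lra.
have ln_pos n : 0 < l ^+ n by rewrite exprn_gt0.
have lnl : 0 < ln l by rewrite ln_gt0.
pose B := 4 + 2 * `|ln kappa| + 2 * ln l.
have B0 : 0 < B by rewrite /B; have := normr_ge0 (ln kappa); lra.
pose c := (c0 * B * l)^-1.
have c_gt0 : 0 < c by rewrite invr_gt0 !mulr_gt0.
have step n : kappa * c * harmonic n <= l ^+ n * t n - l ^+ n.+1 * t n.+1.
  have /andP[tp t1] := t01 n.+1.
  have lnt : 4 - 2 * ln (t n.+1) <= B * n.+1%:R.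
    have : ln kappa <= ln (l ^+ n.+1 * t n.+1) by rewrite ler_ln ?posrE ?mulr_gt0.
    rewrite lnM ?posrE// lnXn// -mulr_natr.
    have n1 : (1 : R) <= n.+1%:R by rewrite ler1n.
    have := ler_norm (- ln kappa); rewrite normrN => a1 a2.
    have : (4 + 2 * `|ln kappa|) * 1 <= (4 + 2 * `|ln kappa|) * n.+1%:R.
      by rewrite ler_wpM2l//; have := normr_ge0 (ln kappa); lra.
    by rewrite /B mulr1; lra.
  have den0 : 0 < 4 - 2 * ln (t n.+1) by have := @ln_lt0 R (t n.+1) (t01 n.+1); lra.
  have n0 : (0 : R) < n.+1%:R by [].
  have inv : (c0 * (B * n.+1%:R))^-1 <= (c0 * (4 - 2 * ln (t n.+1)))^-1.
    by rewrite lef_pV2 ?posrE ?mulr_gt0// ler_wpM2l// ltW.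
  have h1 : l ^+ n * (t n.+1 * (c0 * (B * n.+1%:R))^-1) <=
      l ^+ n * t n - l ^+ n.+1 * t n.+1.
    have h2 : l ^+ n * (l * t n.+1 + t n.+1 / (c0 * (4 - 2 * ln (t n.+1)))) <=
        l ^+ n * t n.
      by rewrite ler_wpM2l// ltW.
    have h3 : l ^+ n * (t n.+1 * (c0 * (B * n.+1%:R))^-1) <=
        l ^+ n * (t n.+1 / (c0 * (4 - 2 * ln (t n.+1)))).
      by rewrite ler_wpM2l ?(ltW (ln_pos n))// ler_wpM2l// ltW.
    rewrite exprSr -mulrA; move: h2 h3; rewrite [l ^+ n * (_ + _)]mulrDr.
    set w := l ^+ n * (l * _) => h2 h3.
    by rewrite lerBrDl; apply: le_trans h2; rewrite lerD2l.
  apply: le_trans h1; rewrite /harmonic /=.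
  have -> : l ^+ n * (t n.+1 * (c0 * (B * n.+1%:R))^-1) =
      (l ^+ n.+1 * t n.+1) * (c * n.+1%:R^-1).
    by rewrite /c exprS; field; rewrite nat1r; apply/and4P; split; rewrite gt_eqF.
  rewrite -mulrA ler_wpM2r ?zk//. by apply: mulr_ge0; [exact: ltW|rewrite invr_ge0].
have tele n : kappa * c * series harmonic n <= t 0%N - l ^+ n * t n.
  elim: n => [|n IH]; first by rewrite /series /= big_geq// mulr0 expr0 mul1r subrr.
  have -> : series (@harmonic R) n.+1 = series harmonic n + harmonic n.
    by rewrite /series /= big_nat_recr.
  by rewrite mulrDr (le_trans (lerD IH (step n)))// addrA subrK.
have [n] := harmonic_unbounded (t 0%N / (kappa * c)).
rewrite ltr_pdivrMr ?mulr_gt0// mulrC; have := tele n; have := zk n; lra.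
Qed.

(** The factor [expR (- (2 * M * t n))] compensates the error term: since
[t n.+1 <= 2 * (t n - t n.+1)], the product
[l ^+ n * s n * expR (- (2 * M * t n))] is nondecreasing. *)
Lemma quadratic_recursion_no_decay (l M : R) (s t : R^nat) : 0 < l -> 0 <= M ->
  (forall n, 0 < s n) -> (forall n, 0 < t n) ->
  (forall n, 3 / 2 * t n.+1 <= t n) ->
  (forall n, s n <= l * s n.+1 * (1 + M * t n.+1)) ->
  forall n, s 0%N * expR (- (2 * M * t 0%N)) <= l ^+ n * s n.
Proof.
move=> l0 M0 s0 t0 tS sS n.
suff : s 0%N * expR (- (2 * M * t 0%N)) <= l ^+ n * s n * expR (- (2 * M * t n)).
  move=> /le_trans; apply; apply: ler_piMr.
    by apply: mulr_ge0; [rewrite exprn_ge0// ltW|exact: ltW].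
  rewrite expR_le1 oppr_le0; apply: mulr_ge0; last exact: ltW.
  by rewrite mulr_ge0.
elim: n => [|n IH]; first by rewrite expr0 mul1r.
apply: le_trans IH _.
have h : 1 + M * t n.+1 <= expR (2 * M * (t n - t n.+1)).
  apply: le_trans (expR_ge1Dx _) _; rewrite ler_expR.
  have : M * (t n - t n.+1) * 2 >= M * t n.+1; last by lra.
  by rewrite -mulrA ler_wpM2l//; have := tS n; lra.
have -> : expR (- (2 * M * t n.+1)) =
    expR (2 * M * (t n - t n.+1)) * expR (- (2 * M * t n)).
  by rewrite -expRD; congr expR; ring.
rewrite mulrA ler_wpM2r ?expR_ge0// exprSr -!mulrA.
apply: ler_wpM2l; first by rewrite exprn_ge0// ltW.
apply: le_trans (sS n) _; rewrite -mulrA.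
by apply: ler_wpM2l; [exact: ltW|apply: ler_wpM2l; [exact: ltW|rewrite mulrA]].
Qed.

End sequences.

(** * Estimates on differentials *)

Section differential_estimates.
Context {R : realType}.
Local Open Scope classical_set_scope.
Local Open Scope ring_scope.
Local Notation V := 'rV[R]_2.

Lemma near0_norm (U : normedModType R) (P : set U) :
  (\forall v \near 0, P v) -> exists2 r : R, 0 < r & forall v, `|v| < r -> P v.
Proof.
by move=> /nbhs_norm0P[r r0 rP]; exists r => // v vr; exact: rP.
Qed.

Lemma diff_remainder (U W : normedModType R) (f : U -> W) (x : U) (e : R) :
  differentiable f x -> 0 < e ->
  \forall v \near (0 : U), `|f (x + v) - f x - 'd f x v| <= e * `|v|.
Proof.
move=> /diff_locallyP[_ /eqaddoP fo] e0; apply: filterS (fo e e0) => v /=.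
by rewrite !fctE /= opprD addrA [v + x]addrC.
Qed.

Lemma diff_lipschitz (U W : normedModType R) (f : U -> W) (x : U) :
  differentiable f x ->
  exists2 C : R, 0 < C & \forall v \near (0 : U), `|f (x + v) - f x| <= C * `|v|.
Proof.
move=> fd; have [k k0 kP] := linear_lipschitz (diff_continuous fd).
exists (k + 1); first by rewrite addr_gt0.
apply: filterS (diff_remainder fd ltr01) => v h.
rewrite -[X in `|X|](subrK ('d f x v)) (le_trans (ler_normD _ _))//.
by rewrite addrC mulrDl lerD.
Qed.

Lemma diff_lipschitz0 (U W : normedModType R) (f : U -> W) :
  differentiable f 0 ->
  exists2 C : R, 0 < C & \forall v \near (0 : U), `|f v - f 0| <= C * `|v|.
Proof.
move=> /diff_lipschitz[C C0 CP]; exists C => //.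
by apply: filterS CP => v; rewrite add0r.
Qed.

Lemma linear_dist_basis (L1 L2 : {linear V -> V}) (y : V) :
  `|L1 y - L2 y| <= (`|L1 (delta_mx 0 0) - L2 (delta_mx 0 0)| +
                     `|L1 (delta_mx 0 1) - L2 (delta_mx 0 1)|) * `|y|.
Proof.
have yE : y = y 0 0 *: delta_mx 0 0 + y 0 1 *: delta_mx 0 1.
  by apply: rV2P; rewrite !mxE /=; ring.
have := lexx `|y|; rewrite {1}norm_rV2_le => /andP[y0 y1].
rewrite {1 2}yE (linearD L1) (linearD L2) !(linearZ_LR L1) !(linearZ_LR L2).
rewrite opprD addrACA -!scalerBr.
rewrite (le_trans (ler_normD _ _))// !normrZ mulrDl.
by apply: lerD; rewrite mulrC; apply: ler_pM.
Qed.

(** The partial derivatives of [G] are differentiable at 0, hence vary by [O(|v|)],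
and the mean value theorem along the segment from 0 to [y] gives one more factor
[|y|]. *)
Lemma quadratic_remainder (U : set V) (G : V -> V) :
  open U -> U 0 -> Cr_on 2 U G ->
  exists2 M : R, 0 < M &
    \forall y \near (0 : V), `|G y - G 0 - 'd G 0 y| <= M * `|y| ^+ 2.
Proof.
move=> Uo U0 [Gd G2].
have lip i : exists2 C : R, 0 < C & \forall v \near (0 : V),
    `|'d G v (delta_mx 0 i) - 'd G 0 (delta_mx 0 i)| <= C * `|v|.
  have [D _] := G2 (delta_mx 0 i).
  exact: (@diff_lipschitz0 _ _ (fun v => 'd G v (delta_mx 0 i)) (D 0 U0)).
have [C0 C0p C0P] := lip 0; have [C1 C1p C1P] := lip 1.
exists (C0 + C1); first by rewrite addr_gt0.
have Un : \forall v \near (0 : V), U v by apply: open_nbhs_nbhs.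
have [r r0 rP] : exists2 r : R, 0 < r & forall v : V, `|v| < r ->
    [/\ U v, `|'d G v (delta_mx 0 0) - 'd G 0 (delta_mx 0 0)| <= C0 * `|v|
      & `|'d G v (delta_mx 0 1) - 'd G 0 (delta_mx 0 1)| <= C1 * `|v|].
  by apply: near0_norm; near=> v; split; near: v.
apply/nbhs_norm0P; exists r => // y /= yr.
have dGb (s : R) : 0 <= s <= 1 ->
    `|'d G (s *: y) y - 'd G 0 y| <= (C0 + C1) * `|y| ^+ 2.
  move=> /andP[s0 s1].
  have sy : `|s *: y| <= `|y| by rewrite normrZ ger0_norm// ler_piMl.
  have [_ h0 h1] := rP _ (le_lt_trans sy yr).
  apply: le_trans (linear_dist_basis _ _ y) _.
  rewrite expr2 mulrA ler_wpM2r// mulrDl.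
  by apply: lerD; [apply: le_trans h0 _|apply: le_trans h1 _];
    rewrite ler_wpM2l// ltW.
rewrite norm_rV2_le.
suff comp i : `|(G y - G 0 - 'd G 0 y) 0 i| <= (C0 + C1) * `|y| ^+ 2.
  by rewrite !comp.
pose phi (s : R) : R := G (s *: y) 0 i - s * ('d G 0 y) 0 i.
pose dphi (s : R) : R := ('d G (s *: y) y) 0 i - ('d G 0 y) 0 i.
have phiD (s : R) : 0 <= s <= 1 -> is_derive s 1 phi (dphi s).
  move=> /andP[s0 s1].
  have sy : `|s *: y| <= `|y| by rewrite normrZ ger0_norm// ler_piMl.
  have [Us _ _] := rP _ (le_lt_trans sy yr).
  have GD := differentiableP (Gd _ Us).
  have D1 : is_diff s (fun s : R => s *: y) (fun h => h *: y) by exact: is_diff_scalel.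
  have D2 := @is_diff_comp _ _ _ _ _ _ _ _ s D1 GD.
  have D3 := @is_diff_comp _ _ _ _ _ _ _ _ s D2 (is_diff_coord2 _ i).
  have D4 : is_derive s 1 (fun s : R => G (s *: y) 0 i : R) ('d G (s *: y) y 0 i).
    have d3 : differentiable (fun s : R => G (s *: y) 0 i : R) s by case: D3.
    split; first exact: diff_derivable.
    by rewrite deriveE// diff_val /= scale1r.
  have D5 : is_derive s 1 (fun s : R => s * 'd G 0 y 0 i) ('d G 0 y 0 i).
    have -> : (fun s : R => s * 'd G 0 y 0 i) = *%R ('d G 0 y 0 i).
      by apply/funext => u; rewrite mulrC.
    by apply: is_derive_eq; rewrite /GRing.scale /= mulr1.
  exact: (is_deriveB D4 D5).
have [||c c01 cE] := @MVT_segment R phi dphi 0 1 ler01.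
- move=> s; rewrite in_itv /= => /andP[s0 s1].
  by apply: phiD; rewrite !ltW.
- apply: derivable_within_continuous => s; rewrite in_itv /= => s01.
  by have [] := phiD s s01.
move: cE; rewrite subr0 mulr1 /phi scale1r scale0r mul1r mul0r subr0 => cE.
rewrite !mxE addrAC cE /dphi.
have := dGb c; move: c01; rewrite in_itv /= => -> /(_ isT).
rewrite norm_rV2_le => /andP[]; rewrite !mxE.
by have [->|->] := ord2_cases i.
Unshelve. all: by end_near. Qed.

End differential_estimates.

(** * The obstruction at the fixed point *)

Section obstruction.
Context {R : realType}.
Local Open Scope classical_set_scope.
Local Open Scope ring_scope.
Local Notation V := 'rV[R]_2.
Local Notation T := (torus2 R).
Local Notation lam := (@lam R).
Local Notation eu := (@eu R).

Lemma cuB (v w : V) : cu (v - w) = cu v - cu w.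
Proof. by rewrite /cu !mxE -mulrBl; congr (_ / _); ring. Qed.

Lemma cuZ (a : R) (v : V) : cu (a *: v) = a * cu v.
Proof. by rewrite /cu !mxE [RHS]mulrA; congr (_ / _); ring. Qed.

Lemma cu_eu : cu eu = 1.
Proof. by rewrite -[eu]scale1r -[_ *: _]add0r -(scale0r (@es R)) cu_es_eu. Qed.

Lemma cu_le (v : V) : `|cu v| <= `|v|.
Proof.
have /andP[l2 _] := @lam_bounds R.
have := lexx `|v|; rewrite {1}norm_rV2_le => /andP[/ler_normlP[a b] /ler_normlP[c d]].
have D0 : 0 < 1 + lam ^+ 2 by nra.
set m := `|v| in a b c d *; have m0 : 0 <= m by rewrite /m.
have h1 : lam * v 0 0 <= lam * m by rewrite ler_wpM2l//; lra.
have h2 : lam * - v 0 0 <= lam * m by rewrite ler_wpM2l//; lra.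
have h3 : lam * m <= m * lam ^+ 2 by rewrite mulrC ler_wpM2l//; nra.
rewrite /cu normrM normfV (gtr0_norm D0) ler_pdivrMr// mulrDr mulr1.
by apply/ler_normlP; split; lra.
Qed.

Lemma Fcat_eu t : Fcat (t *: eu) = Phi t *: eu.
Proof.
have l2 : lam ^+ 2 = 2 * lam + 1 := lam_sqr.
have : t * lam ^+ 2 = t * (2 * lam + 1) by rewrite l2.
by move=> tl; apply: rV2P; rewrite /Phi /Fcat !mxE /= !mulr1; lra.
Qed.

Lemma cu_dFcat0 v : cu (dFcat 0 v) = lam * cu v.
Proof.
have l2 : lam ^+ 2 = 2 * lam + 1 := lam_sqr.
have : v 0 0 * lam ^+ 2 = v 0 0 * (2 * lam + 1) by rewrite l2.
move=> h; rewrite /dFcat /cu !mxE /= dpsi0 [RHS]mulrA; congr (_ / _); lra.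
Qed.

(** [Phi] fixes 0 and expands by at least [3 / 2], so its inverse maps positive numbers
to smaller positive ones. *)
Lemma unstable_orbit (d : R) : 0 < d -> exists t : R^nat, [/\ t 0%N = d,
  forall n, 0 < t n, forall n, Phi (t n.+1) = t n & forall n, 3 / 2 * t n.+1 <= t n].
Proof.
move=> d0; have c0 : (0 : R) < 3 / 2 by lra.
have [th [_ thK _]] := derivable_inverse c0 (@is_derive_Phi R) (@dPhi_ge R).
have E := derive_lower_bound_expands (@is_derive_Phi R) (@dPhi_ge R).
have Phi0 : Phi 0 = 0 :> R by rewrite /Phi mulr0 psi0 addr0.
have th0 t : 0 < t -> 0 < th t.
  move=> t0; rewrite ltNge; apply/negP => tht.
  have := E _ _ tht; rewrite Phi0 thK; lra.
exists (fun n => iter n th d).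
have pos n : 0 < iter n th d by elim: n => //= n; exact: th0.
split => // n /=; first by rewrite thK.
by have := E 0 _ (ltW (th0 _ (pos n))); rewrite thK Phi0; lra.
Qed.

(** [G], [H], [K] are the germs of the smooth map, of the conjugacy and of its
inverse. Since [dK] intertwines [dG] with [dFcat 0], the form [u = cu \o dK]
satisfies [u (dG v) = lam * u v], and [u (H (t *: eu)) = t + o(t)]. Hence
[s n = u (y n)] is comparable to [t n] and satisfies a quadratic recursion. *)
Lemma no_smooth_germ (G H K dG dH dK : V -> V) (M : R) :
  is_diff 0 G dG -> is_diff 0 H dH -> is_diff 0 K dK ->
  H 0 = 0 -> G 0 = 0 -> K 0 = 0 ->
  (\forall v \near (0 : V), K (H v) = v) ->
  (\forall v \near (0 : V), K (G v) = Fcat (K v)) ->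
  (forall v, G (H v) = H (Fcat v)) ->
  0 < M -> (\forall y \near (0 : V), `|G y - dG y| <= M * `|y| ^+ 2) -> False.
Proof.
move=> GD HD KD H0 G0 K0 KH KG GH M0 Grem.
have KDH : is_diff (H 0) K dK by rewrite H0.
have KDG : is_diff (G 0) K dK by rewrite G0.
have FDK : is_diff (K 0) (@Fcat R) (dFcat 0) by rewrite K0; exact: is_diff_Fcat.
have dKH v : dK (dH v) = v.
  have D1 := near_is_diff KH (@is_diff_comp _ _ _ _ _ _ _ _ (0 : V) HD KDH).
  have [_ e1] := D1.
  have [_ e2] := is_diff_id (0 : V).
  by have := congr1 (fun f => f v) (etrans (esym e1) e2).
have dKG v : dK (dG v) = dFcat 0 (dK v).
  have D1 := near_is_diff KG (@is_diff_comp _ _ _ _ _ _ _ _ (0 : V) GD KDG).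
  have D2 := @is_diff_comp _ _ _ _ _ _ _ _ (0 : V) KD FDK.
  have [_ e1] := D1.
  have [_ e2] := D2.
  by have := congr1 (fun f => f v) (etrans (esym e1) e2).
have Kd : differentiable K 0 by [].
have dKE : 'd K 0 = dK :> (V -> V) by exact: diff_val.
have [kK kK0 kKP] : exists2 k : R, 0 < k & forall v, `|'d K 0 v| <= k * `|v|.
  exact: linear_lipschitz (diff_continuous Kd).
have dKlin v w : dK (v - w) = dK v - dK w by rewrite -dKE linearB.
have {}kKP v : `|dK v| <= kK * `|v| by rewrite -dKE.
have Hd : differentiable H 0 by [].
have dHE : 'd H 0 = dH :> (V -> V) by exact: diff_val.
have dHZ t v : dH (t *: v) = t *: dH v by rewrite -dHE linearZ.
have [C C0 HC] := diff_lipschitz0 Hd.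
have ne0 : 0 < `|eu|.
  rewrite normr_gt0; apply/eqP => /(congr1 (@cu R)).
  by rewrite cu_eu -(scale0r eu) cuZ mul0r => /eqP; rewrite oner_eq0.
(* With this [e], the remainder of [H] moves the unstable coordinate of
   [t *: eu] by at most [t / 2]. *)
pose e := (2 * kK * `|eu|)^-1.
have e0 : 0 < e by rewrite invr_gt0 !mulr_gt0.
have Hrem := diff_remainder Hd e0.
have [r1 r10 r1P] : exists2 r : R, 0 < r & forall v : V, `|v| < r ->
    `|H v| <= C * `|v| /\ `|H v - dH v| <= e * `|v|.
  apply: near0_norm; apply: filterS2 HC Hrem => v.
  by rewrite H0 dHE add0r !subr0.
have [r2 r20 r2P] := near0_norm Grem.
have [d /andP[d0 d1] psid] := @psi_lower R.
pose u v := cu (dK v).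
have /andP[l2 l3] := @lam_bounds R.
(* [t] decreases, so a small [t 0] keeps the whole orbit in the domains of the
   three local estimates. *)
pose t0 : R := Num.min (d / 2) (Num.min (r1 / `|eu| / 2 : R) (r2 / (C * `|eu|) / 2)).
have t00 : 0 < t0 by rewrite /t0 !lt_min !divr_gt0 ?mulr_gt0.
have /and3P[t0d t0r1 t0r2] : [&& t0 <= d / 2, t0 <= r1 / `|eu| / 2
    & t0 <= r2 / (C * `|eu|) / 2] by rewrite -!le_min lexx.
clearbody t0.
have [t [tE tp tPhi tS]] := unstable_orbit t00.
have tle n : t n <= t0.
  by elim: n => [|n IH]; rewrite ?tE//; have := tS n; have := tp n.+1; lra.
have td n : t n < d.
  by have := tle n; lra.
have tr1 n : t n * `|eu| < r1.
  rewrite -ltr_pdivlMr//; have := tle n.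
  have : 0 < r1 / `|eu| by rewrite divr_gt0.
  by lra.
have tr2 n : C * (t n * `|eu|) < r2.
  rewrite mulrCA -ltr_pdivlMr ?mulr_gt0//; have := tle n.
  have : 0 < r2 / (C * `|eu|) by rewrite divr_gt0 ?mulr_gt0.
  by lra.
pose y n := H (t n *: eu).
pose s n := u (y n).
have nt n : `|t n *: eu| = t n * `|eu| by rewrite normrZ gtr0_norm.
have yb n : `|y n| <= C * (t n * `|eu|).
  by have := r1P (t n *: eu); rewrite nt => /(_ (tr1 n))[].
have st n : `|s n - t n| <= t n / 2.
  have -> : s n - t n = cu (dK (y n - dH (t n *: eu))).
    by rewrite dKlin cuB /s /u dKH cuZ cu_eu mulr1.
  apply: le_trans (cu_le _) _; apply: le_trans (kKP _) _.
  have := r1P (t n *: eu); rewrite nt => /(_ (tr1 n))[_ h].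
  have -> : t n / 2 = kK * (e * (t n * `|eu|)) by rewrite /e; field; rewrite !gt_eqF.
  by rewrite ler_wpM2l// ltW.
have sb n : t n / 2 <= s n /\ s n <= 3 / 2 * t n.
  by have /ler_normlP[h1 h2] := st n; split; lra.
have Gy n : G (y n.+1) = y n by rewrite /y GH Fcat_eu tPhi.
pose B := 2 * kK * M * (C * `|eu|) ^+ 2.
have B0 : 0 <= B by rewrite !mulr_ge0 ?exprn_ge0// ?mulr_ge0// ltW.
have sS n : s n <= lam * s n.+1 * (1 + B * t n.+1).
  have h : s n - lam * s n.+1 <= kK * (M * `|y n.+1| ^+ 2).
    have -> : s n - lam * s n.+1 = cu (dK (G (y n.+1) - dG (y n.+1))).
      by rewrite dKlin cuB dKG cu_dFcat0 Gy.
    apply: le_trans (ler_norm _) _; apply: le_trans (cu_le _) _.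
    apply: le_trans (kKP _) _; apply: ler_wpM2l; first exact: ltW.
    by apply: r2P; exact: le_lt_trans (yb _) (tr2 _).
  have y2 : `|y n.+1| ^+ 2 <= (C * (t n.+1 * `|eu|)) ^+ 2.
    by rewrite ler_pXn2r ?nnegrE// (le_trans _ (yb _)).
  have h2 : kK * (M * `|y n.+1| ^+ 2) <= kK * (M * (C * (t n.+1 * `|eu|)) ^+ 2).
    by rewrite (ler_wpM2l (ltW kK0))// (ler_wpM2l (ltW M0)).
  have [s1 s2] := sb n.+1; have tn := tp n.+1.
  have h3 : kK * (M * (C * (t n.+1 * `|eu|)) ^+ 2) <= B * t n.+1 * s n.+1.
    have -> : kK * (M * (C * (t n.+1 * `|eu|)) ^+ 2) = B * t n.+1 * (t n.+1 / 2).
      by rewrite /B; field.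
    by rewrite ler_wpM2l// mulr_ge0// ltW.
  have h4 : B * t n.+1 * s n.+1 <= lam * (B * t n.+1 * s n.+1).
    have q : 0 <= B * t n.+1 * s n.+1.
      by apply: mulr_ge0; [apply: mulr_ge0 => //; exact: ltW|lra].
    by rewrite ler_peMl//; lra.
  have : lam * s n.+1 * (B * t n.+1) = lam * (B * t n.+1 * s n.+1) by ring.
  by rewrite mulrDr mulr1; lra.
have sp n : 0 < s n by have [s1 _] := sb n; have := tp n; lra.
have l0 : 0 < lam by lra.
have low := quadratic_recursion_no_decay l0 B0 sp tp tS sS.
set kap := s 0%N * _ in low.
have kap0 : 0 < kap by rewrite mulr_gt0// expR_gt0.
have l1 : 1 < lam by lra.
have t01 n : 0 < t n < 1 by rewrite tp /= (lt_trans (td n)).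
have step n : lam * t n.+1 + t n.+1 / (8 * (4 - 2 * ln (t n.+1))) <= t n.
  by rewrite -(tPhi n) /Phi lerD2l psid// tp td.
have kap2 : 0 < kap / 2 by rewrite divr_gt0.
have [n nE] := slow_profile_forces_decay l1 (ltr0Sn _ 7) t01 step kap2.
have := low n; have [_ s2] := sb n.
have : lam ^+ n * s n <= lam ^+ n * (3 / 2 * t n).
  by rewrite ler_wpM2l// exprn_ge0// ltW.
rewrite mulrCA; lra.
Qed.

End obstruction.

(** * From germs to the torus *)

Section torus_germs.
Context {R : realType}.
Local Open Scope classical_set_scope.
Local Open Scope ring_scope.
Local Notation V := 'rV[R]_2.
Local Notation T := (torus2 R).

Lemma tlog0 : tlog (0 : T) = 0.
Proof. by rewrite -tpi0 tpiK// normr0 invr_gt0. Qed.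

Lemma near_tpiK : \forall v \near (0 : V), tlog (tpi v) = v.
Proof.
by apply/nbhs_norm0P; exists 2^-1 => [|v /= v2]; [rewrite /= invr_gt0|rewrite tpiK].
Qed.

Lemma in_chart0 (f : T -> T) p : in_chart f p 0 = 0.
Proof. by rewrite /in_chart tpi0 addr0 subrr tlog0. Qed.

(** As [tpi \o tlog] is the identity on the whole torus, charts compose exactly,
with no restriction to a neighbourhood. *)
Lemma tpi_in_chart (f : T -> T) p v : f p + tpi (in_chart f p v) = f (p + tpi v).
Proof. by rewrite /in_chart tlogK addrC subrK. Qed.

Lemma in_chart_comp (f g : T -> T) p v :
  in_chart f (g p) (in_chart g p v) = in_chart (f \o g) p v.
Proof. by rewrite /in_chart -/(in_chart g p v) tpi_in_chart. Qed.

Lemma Cr_diff (f : T -> T) r p : Cr r.+1 f -> is_diff 0 (in_chart f p) (tangent f p).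
Proof.
move=> /(_ p)[U [Uo U0 [Ud _]]]; exact: differentiableP (Ud 0 U0).
Qed.

Lemma in_chart_lifts0 (f : T -> T) F : lifts f F -> F 0 = 0 -> {for 0, continuous F} ->
  \forall v \near (0 : V), in_chart f 0 v = F v.
Proof.
move=> fF F0; rewrite /prop_for /continuous_at F0 => Fc.
have : \forall v \near (0 : V), tlog (tpi (F v)) = F v := Fc _ near_tpiK.
apply: filterS => v Fv.
by rewrite -{1}tpi0 (in_chart_lifts _ _ fF) add0r F0 subr0.
Qed.

Lemma Cr_on_cst (W1 W2 : normedModType R) r (U : set W1) (c : W2) (F : W1 -> W2) :
  open U -> (forall x, U x -> F x = c) -> Cr_on r U F.
Proof.
move=> Uo; have D e (f : W1 -> W2) x :
    (forall x, U x -> f x = e) -> U x -> is_diff x f 0.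
  move=> fe Ux; apply: near_is_diff (is_diff_cst e x).
  have : \forall y \near x, U y by apply: open_nbhs_nbhs.
  by apply: filterS => y /fe ->.
elim: r c F => [|r IH] c F Fc.
  by move=> x Ux; have [d _] := D c F x Fc Ux; exact: differentiable_continuous d.
split=> [x Ux|v]; first by have [d _] := D c F x Fc Ux.
by apply: (IH 0) => x Ux; have [_ ->] := D c F x Fc Ux.
Qed.

Lemma Cr_id r : Cr r (@id T).
Proof.
move=> p; pose U := [set v : V | `|v| < 2^-1].
have Uo : open U.
  rewrite (_ : U = Num.norm @^-1` [set r | r < 2^-1 :> R]) //.
  by apply: open_comp; [move=> v _; exact: norm_continuous|exact: open_lt].
exists U; split => //; first by rewrite /U /= normr0 invr_gt0.
have idE v : U v -> in_chart (@id T) p v = v.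
  by move=> Uv; rewrite /in_chart addrAC subrr add0r tpiK.
have D v : U v -> is_diff v (in_chart (@id T) p) id.
  move=> Uv; apply: near_is_diff (is_diff_id v).
  have : \forall y \near v, U y by apply: open_nbhs_nbhs.
  by apply: filterS => y /idE ->.
case: r => [|r].
  by move=> v Uv; have [d _] := D v Uv; exact: differentiable_continuous d.
split=> [v Uv|w]; first by have [d _] := D v Uv.
by apply: (@Cr_on_cst _ _ r U w) => // v Uv; have [_ ->] := D v Uv.
Qed.

Lemma homotopic_id_id : homotopic_id (@id T).
Proof.
exists snd; split => //; apply: continuous_subspaceT.
by move=> x; exact: cvg_snd.
Qed.

(** [h 0] is a fixed point of [g], and the charts there turn [g \o h = h \o fcat],
[k \o g = fcat \o k] and [k \o h = id] into the hypotheses of [no_smooth_germ]. *)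
Lemma fcat_not_C3_conj g : Cr 3 g ->
  ~ exists h k, diffeo 1 h k /\ g = (h \o @fcat R \o k)%FUN.
Proof.
move=> g3 [h [k [[hK kK h1 k1] gE]]].
pose p : T := h 0.
have kp : k p = 0 by rewrite /p hK.
have F0 : Fcat 0 = 0 :> V.
  by rewrite -(scale0r (@eu R)) Fcat_eu /Phi psi0 mulr0 addr0.
have f0 : @fcat R 0 = 0 by rewrite -tpi0 fcat_lifts F0.
have gp : g p = p by rewrite gE /= kp f0.
have gh : g \o h = h \o @fcat R by apply/funext => z; rewrite gE /= hK.
have kg : k \o g = @fcat R \o k by apply/funext => z; rewrite gE /= hK.
have kh : k \o h = id by apply/funext => z; rewrite /= hK.
have [U [Uo U0 [Gd G3]]] := g3 p.
have G2 : Cr_on 2 U (in_chart g p).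
  split=> // v; have [d1 d2] := G3 v; split => // w.
  by move=> x Ux; have [d3 _] := d2 w; exact: differentiable_continuous (d3 x Ux).
have [M M0 MP] := quadratic_remainder Uo U0 G2.
have fc : {for 0, continuous (@Fcat R)}.
  by case: (is_diff_Fcat (0 : V)) => d _; exact: differentiable_continuous d.
have fF := in_chart_lifts0 fcat_lifts F0 fc.
have Kd := Cr_diff p k1.
have KH : \forall v \near (0 : V), in_chart k p (in_chart h 0 v) = v.
  apply: filterS near_tpiK => v vE.
  by rewrite (in_chart_comp k h 0) kh /in_chart add0r subr0.
have KG : \forall v \near (0 : V),
    in_chart k p (in_chart g p v) = Fcat (in_chart k p v).
  have Kc : {for 0, continuous (in_chart k p)}.
    by case: Kd => d _; exact: differentiable_continuous d.
  rewrite /prop_for /continuous_at in_chart0 in Kc.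
  have : \forall v \near (0 : V), in_chart fcat 0 (in_chart k p v) =
      Fcat (in_chart k p v) := Kc _ fF.
  apply: filterS => v <-.
  by rewrite -{1}gp in_chart_comp kg -kp -in_chart_comp.
have GH v : in_chart g p (in_chart h 0 v) = in_chart h 0 (Fcat v).
  by rewrite (in_chart_comp g h 0) gh /in_chart !add0r /= fcat_lifts f0.
have Grem : \forall y \near (0 : V), `|in_chart g p y - tangent g p y| <= M * `|y| ^+ 2.
  by apply: filterS MP => v; rewrite in_chart0 subr0.
exact: (no_smooth_germ (Cr_diff p g3) (Cr_diff 0 h1) Kd (in_chart0 _ _)
  (in_chart0 _ _) (in_chart0 _ _) KH KG GH M0 Grem).
Qed.

End torus_germs.

(** A surjection [teich_map] would reach the orbit of [fcat] from the orbit of some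
C^3 map [g]; as [g] belongs to the image of its own orbit, it is C^1 conjugate to
[fcat]. *)
Theorem corollaryJ (R : realType) :
  ~ set_surj (teichmuller R 3) (teichmuller R 1) (teich_map R 1) /\
  (exists2 f : torus2 R -> torus2 R, anosov R 1 f &
     forall g, anosov R 3 g ->
       ~ exists h k, diffeo 1 h k /\ g = (h \o f \o k)%FUN).
Proof.
have obstruction g : anosov R 3 g ->
    ~ exists h k, diffeo 1 h k /\ g = (h \o fcat \o k)%FUN.
  by move=> [[l [_ _ g3 _]] _]; exact: fcat_not_C3_conj.
split; last by exists fcat; [exact: anosov_fcat|exact: obstruction].
have diffeo_id r : diffeo r (@id (torus2 R)) id by split=> //; exact: Cr_id.
move=> surj; have [|C [g gA <-] Cf] := surj (conj_orbit 1 fcat).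
  by exists fcat; first exact: anosov_fcat.
apply: (obstruction g gA).
have : teich_map R 1 (conj_orbit 3 g) g.
  by exists g; exists id, id; split => //; exact: homotopic_id_id.
by rewrite Cf => -[h [k [hk _ gE]]]; exists h, k.
Qed.
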